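(* Let $d \geq 3$ and $1 \leq r < \frac{d}{2}$ be integers, and let $q = e^{2\pi i\tau}$ with $\tau$ in the upper half-plane. Then \[ \mathscr{C}_{d,r}(q) = -q^{-\frac{d}{12} + \frac{r}{2}} \frac{\vartheta\left(\frac12 + r\tau; d\tau\right)}{\eta(d\tau)}\, g_3\left(-q^r; q^d\right). \]
   Context: $C_{d,r}(n)$ counts partitions $\lambda_1 \geq \dots \geq \lambda_k$ of $n$ such that every part is congruent to $0, \pm r \pmod d$, consecutive parts satisfy $\lambda_i - \lambda_{i+1} \geq d$, with $\lambda_i - \lambda_{i+1} > d$ whenever $d \mid \lambda_i$, and the smallest part is larger than $d$; $\mathscr{C}_{d,r}(q) := \sum_{n\geq0} C_{d,r}(n)q^n$ (with $C_{d,r}(0)=1$). Here $q^{a} := e^{2\pi i a\tau}$ for rational $a$; $\eta(\tau) := q^{1/24}\prod_{n \geq 1}(1-q^n)$; $\vartheta(w;\tau) := \sum_{n \in \frac12 + \mathbb{Z}} e^{\pi i n^2 \tau + 2\pi i n (w + \frac12)}$; $(a;q)_n := \prod_{j=0}^{n-1}(1-aq^j)$; and Hickerson's universal mock theta function is $g_3(x;q) := \sum_{n \geq 0} \frac{q^{n(n+1)}}{(x;q)_{n+1}(x^{-1}q;q)_{n+1}}$. *)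

(* Defs.v *)
From Stdlib Require Import Reals ZArith List Arith.
From Coquelicot Require Import Coquelicot.
Import ListNotations.
Open Scope R_scope.

Definition cexp (z : C) : C :=
  (exp (Re z) * cos (Im z), exp (Re z) * sin (Im z)).

Definition qp (tau : C) (a : R) : C :=
  cexp (Cmult (Cmult (RtoC (2 * PI * a)) Ci) tau).

Fixpoint subseqs {A : Type} (l : list A) : list (list A) :=
  match l with
  | [] => [[]]
  | x :: t => map (cons x) (subseqs t) ++ subseqs t
  end.

Definition part_residue_ok (d r p : nat) : bool :=
  let m := p mod d in
  Nat.eqb m 0%nat || Nat.eqb m r || Nat.eqb m (d - r).

Definition gap_ok (d a b : nat) : bool :=
  Nat.leb (b + d) a && (negb (Nat.eqb (a mod d) 0%nat) || Nat.ltb (b + d) a).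

Fixpoint gaps_ok (d : nat) (l : list nat) : bool :=
  match l with
  | a :: ((b :: _) as t) => gap_ok d a b && gaps_ok d t
  | _ => true
  end.

Fixpoint last_gt (d : nat) (l : list nat) : bool :=
  match l with
  | [] => true
  | [a] => Nat.ltb d a
  | _ :: t => last_gt d t
  end.

Definition sumlist (l : list nat) : nat := fold_right Nat.add 0%nat l.

Definition valid_part (d r n : nat) (l : list nat) : bool :=
  Nat.eqb (sumlist l) n && forallb (part_residue_ok d r) l
  && gaps_ok d l && last_gt d l.

(** Since d >= 1, valid partitions have distinct parts in [1, n], hence
    are exactly the subsequences of [n; n-1; ...; 1] that are valid. *)
Definition Ccount (d r n : nat) : nat :=
  length (filter (valid_part d r n) (subseqs (rev (seq 1%nat n)))).

Definition is_zseries (f : Z -> C) (l : C) : Prop :=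
  exists a b : C,
    is_series (fun k : nat => f (Z.of_nat k)) a /\
    is_series (fun k : nat => f (- Z.of_nat k - 1)%Z) b /\
    l = Cplus a b.

Fixpoint cprod (n : nat) (f : nat -> C) : C :=
  match n with
  | O => RtoC 1
  | S k => Cmult (cprod k f) (f k)
  end.

Definition is_prod1 (f : nat -> C) (l : C) : Prop :=
  filterlim (fun N : nat => cprod N (fun j => f (S j))) eventually (locally l).

Definition qpoch (a Q : C) (n : nat) : C :=
  cprod n (fun j => Cminus (RtoC 1) (Cmult a (pow_n Q j))).

Definition is_eta (tau : C) (v : C) : Prop :=
  exists P : C, is_prod1 (fun n => Cminus (RtoC 1) (qp tau (INR n))) P
             /\ v = Cmult (qp tau (1/24)) P.

Definition theta_term (w tau : C) (m : Z) : C :=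
  let n := RtoC (IZR m + 1/2) in
  cexp (Cplus (Cmult (Cmult (RtoC PI) Ci) (Cmult (Cmult n n) tau))
              (Cmult (Cmult (RtoC (2 * PI)) Ci)
                     (Cmult n (Cplus w (RtoC (1/2)))))).

Definition is_theta (w tau : C) (v : C) : Prop :=
  is_zseries (theta_term w tau) v.

Definition g3_term (x Q : C) (n : nat) : C :=
  Cdiv (pow_n Q (n * (n + 1)))
       (Cmult (qpoch x Q (S n)) (qpoch (Cmult (Cinv x) Q) Q (S n))).

Definition is_g3 (x Q : C) (v : C) : Prop :=
  is_series (g3_term x Q) v.

(* Main.v *)
(** Put Q = q^d, a = -q^r and b = -q^(d-r), so that ab = Q.  Removing the smallest part shows
    that the generating function f(x) of the partitions without the condition on the smallest
    part, with x marking the number of parts, satisfies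
      f(x) = (1 - x(a + b)) f(xQ) + xQ(1 - xQ) f(xQ^2),
    and the required series is f(Q).  Up to the factor (x;Q)_oo the solution with f(0) = 1 is
    sum_n (a;Q)_n (b;Q)_n x^n / (Q;Q)_n.  Only the values x = Q^k are needed, so everything is
    done with the sequence k |-> f(Q^k); the uniqueness of the solution tending to 1 is
    obtained from a stability estimate on the truncations to parts at most Md.
    At x = Q the hypergeometric series is expanded in g_3 by iterating the relation
      G(a,b) = (aQ;Q)_oo (bQ;Q)_oo + abQ G(aQ,bQ),
      G(a,b) = (Q;Q)_oo sum_n (a;Q)_n (b;Q)_n Q^n / (Q;Q)_n,
    which telescopes.  The remaining factor (a;Q)_oo (b;Q)_oo is the theta quotient, by the
    Jacobi triple product, obtained here as the limit of the finite q-binomial theorem. *)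
Require Import Defs.
From Stdlib Require Import Reals ZArith List Arith Lra Lia.
From Coquelicot Require Import Coquelicot.
Import ListNotations.
Open Scope R_scope.

Local Open Scope C_scope.

(** * Limits and geometrically dominated series in C *)

(** Adding d to every part keeps all residues and gaps, so f(Q^k) enumerates the partitions with all
    parts above kd; this is why the sequence k |-> f(Q^k) suffices and the smallest part being
    larger than d means k = 1. With parts also bounded by Md every sum over partitions is finite,
    and the values at k = M - 1 and k = M are known exactly. The recurrence is then run downwards in
    k: the moduli of its two coefficients add up to at most 1 + 4|Q|^k in the indexing by [qsol], so
    an error at the top is amplified by a bounded factor only, and no convergence of infinite sums
    over partitions is needed beforehand. The second coefficient xQ(1 - xQ) comes from eliminating
    an auxiliary sum with threshold kd + r, because the residues r and d - r each shift their own
    threshold. Truncations by size of the largest part and by the number partitioned are compared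
    through |q|^s = rho^s rho^s with rho = sqrt |q|: one factor makes the difference small, the
    other keeps the sum over partitions bounded. *)

Definition clim (u : nat -> C) (l : C) : Prop :=
  is_lim_seq (fun n => Cmod (u n - l)) 0%R.

(** Needed only to reach the filter form behind [is_series] and [is_prod1]; all estimates stay with
    real sequences, where squeezing is available. *)
Lemma clim_filterlim (u : nat -> C) (l : C) :
  clim u l -> filterlim u eventually (locally l).
Proof.
  intros H.
  apply (proj2 (@filterlim_locally_ball_norm C_AbsRing nat C_NormedModule eventually _ u l)).
  intros eps. apply is_lim_seq_spec in H. specialize (H eps).
  destruct H as [N HN]. exists N; intros n Hn. specialize (HN n Hn).
  unfold ball_norm. rewrite Rminus_0_r, Rabs_pos_eq in HN by apply Cmod_ge_0.
  exact HN.
Qed.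

Lemma clim_le (u : nat -> C) (l : C) (e : nat -> R) :
  (forall n, Cmod (u n - l) <= e n)%R -> is_lim_seq e 0%R -> clim u l.
Proof.
  intros H He. apply is_lim_seq_le_le with (u := fun _ => 0%R) (w := e); auto.
  - intros n; split; [apply Cmod_ge_0 | apply H].
  - apply is_lim_seq_const.
Qed.

Lemma clim_ext (u v : nat -> C) (l : C) :
  (forall n, u n = v n) -> clim u l -> clim v l.
Proof.
  intros H. apply is_lim_seq_ext. intros n; now rewrite H.
Qed.

Lemma clim_const (l : C) : clim (fun _ => l) l.
Proof.
  apply clim_le with (e := fun _ => 0%R); [|apply is_lim_seq_const].
  intros _. replace (l - l) with (RtoC 0) by ring. rewrite Cmod_0; lra.
Qed.

Lemma clim_plus (u v : nat -> C) (l m : C) :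
  clim u l -> clim v m -> clim (fun n => u n + v n) (l + m).
Proof.
  intros Hu Hv.
  apply clim_le with (e := fun n => (Cmod (u n - l) + Cmod (v n - m))%R).
  - intros n. replace (u n + v n - (l + m)) with ((u n - l) + (v n - m)) by ring.
    apply Cmod_triangle.
  - replace (Finite 0) with (Finite (0 + 0)) by (f_equal; ring).
    now apply is_lim_seq_plus'.
Qed.

Lemma clim_mult (u v : nat -> C) (l m : C) :
  clim u l -> clim v m -> clim (fun n => u n * v n) (l * m).
Proof.
  intros Hu Hv.
  apply clim_le with (e := fun n =>
    (Cmod (u n - l) * (Cmod (v n - m) + Cmod m) + Cmod l * Cmod (v n - m))%R).
  - intros n.
    replace (u n * v n - l * m) with ((u n - l) * ((v n - m) + m) + l * (v n - m)) by ring.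
    eapply Rle_trans; [apply Cmod_triangle|]. rewrite !Cmod_mult.
    apply Rplus_le_compat_r, Rmult_le_compat_l; [apply Cmod_ge_0 | apply Cmod_triangle].
  - replace (Finite 0) with (Finite (0 * (0 + Cmod m) + Cmod l * 0)) by (f_equal; ring).
    apply is_lim_seq_plus'; apply is_lim_seq_mult';
      auto using is_lim_seq_const.
    apply is_lim_seq_plus'; auto using is_lim_seq_const.
Qed.

Lemma clim_scal (u : nat -> C) (c l : C) :
  clim u l -> clim (fun n => c * u n) (c * l).
Proof. intros H. apply clim_mult; auto using clim_const. Qed.

Lemma clim_minus (u v : nat -> C) (l m : C) :
  clim u l -> clim v m -> clim (fun n => u n - v n) (l - m).
Proof.
  intros Hu Hv.
  replace (l - m) with (l + (-(1)) * m) by ring.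
  apply clim_ext with (u := fun n => u n + (-(1)) * v n); [intros; ring|].
  apply clim_plus; auto using clim_scal.
Qed.

Lemma clim_dist_le (u : nat -> C) (l c : C) (B : R) :
  (forall n, Cmod (u n - c) <= B)%R -> clim u l -> (Cmod (l - c) <= B)%R.
Proof.
  intros H Hu.
  assert (Hl : is_lim_seq (fun n => (Cmod (u n - l) + B)%R) (0 + B)%R)
    by (apply is_lim_seq_plus'; auto using is_lim_seq_const).
  rewrite Rplus_0_l in Hl.
  apply (is_lim_seq_le (fun _ => Cmod (l - c)) (fun n => (Cmod (u n - l) + B)%R)
           (Cmod (l - c)) B); auto using is_lim_seq_const.
  intros n. replace (l - c) with (- (u n - l) + (u n - c)) by ring.
  eapply Rle_trans; [apply Cmod_triangle|]. rewrite Cmod_opp.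
  apply Rplus_le_compat_l, H.
Qed.

Lemma clim_mod_le (u : nat -> C) (l : C) (B : R) :
  (forall n, Cmod (u n) <= B)%R -> clim u l -> (Cmod l <= B)%R.
Proof.
  intros H Hu. replace l with (l - 0) by ring.
  apply clim_dist_le with u; auto. intros n. now replace (u n - 0) with (u n) by ring.
Qed.

Lemma clim_mod_ge (u : nat -> C) (l : C) (B : R) :
  (forall n, B <= Cmod (u n))%R -> clim u l -> (B <= Cmod l)%R.
Proof.
  intros H Hu.
  assert (Hl : is_lim_seq (fun n => (Cmod (u n - l) + Cmod l)%R) (0 + Cmod l)%R)
    by (apply is_lim_seq_plus'; auto using is_lim_seq_const).
  rewrite Rplus_0_l in Hl.
  apply (is_lim_seq_le (fun _ => B) (fun n => (Cmod (u n - l) + Cmod l)%R)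
           B (Cmod l)); auto using is_lim_seq_const.
  intros n. eapply Rle_trans; [apply (H n)|].
  eapply Rle_trans; [|apply Cmod_triangle]. right; f_equal; ring.
Qed.

Lemma clim_unique (u : nat -> C) (l m : C) : clim u l -> clim u m -> l = m.
Proof.
  intros Hl Hm.
  assert (H := clim_minus _ _ _ _ Hl Hm).
  assert (H0 : (Cmod (l - m) <= 0)%R).
  { apply clim_mod_le with (2 := H). intros n.
    replace (u n - u n) with (RtoC 0) by ring. rewrite Cmod_0; lra. }
  assert (H1 : l - m = 0) by (apply Cmod_eq_0, Rle_antisym; auto using Cmod_ge_0).
  replace l with (l - m + m) by ring. rewrite H1; ring.
Qed.

(** The bound m passes to the limit, so the inverses differ by at most |u n - l| / m^2. *)
Lemma clim_inv (u : nat -> C) (l : C) (m : R) :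
  (0 < m)%R -> (forall n, m <= Cmod (u n))%R -> clim u l ->
  clim (fun n => / u n) (/ l).
Proof.
  intros Hm Hu Hl. assert (Hml := clim_mod_ge _ _ _ Hu Hl).
  assert (nz : forall z, (m <= Cmod z)%R -> z <> 0)
    by (intros z Hz; apply Cmod_gt_0; lra).
  apply clim_le with (e := fun n => (/ (m * m) * Cmod (u n - l))%R).
  - intros n. specialize (Hu n).
    replace (/ u n - / l) with (- (/ (u n * l) * (u n - l))) by (field; split; auto).
    rewrite Cmod_opp, Cmod_mult, Cmod_inv, Cmod_mult
      by (apply Cmult_neq_0; auto).
    apply Rmult_le_compat_r; [apply Cmod_ge_0|].
    apply Rinv_le_contravar; [nra|]. apply Rmult_le_compat; lra.
  - replace (Finite 0) with (Finite (/ (m * m) * 0)) by (f_equal; ring).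
    apply is_lim_seq_mult'; auto using is_lim_seq_const.
Qed.

Lemma clim_subseq (u : nat -> C) (l : C) (phi : nat -> nat) :
  (forall N, exists N', forall n, (N' <= n)%nat -> (N <= phi n)%nat) ->
  clim u l -> clim (fun n => u (phi n)) l.
Proof.
  intros H Hu. apply (is_lim_seq_subseq (fun n => Cmod (u n - l)) 0%R phi); auto.
  intros P [N HN]. destruct (H N) as [N' HN']. exists N'. intros n Hn. auto.
Qed.

Lemma clim_ext_ge (u v : nat -> C) (l : C) (N : nat) :
  (forall n, (N <= n)%nat -> u n = v n) -> clim u l -> clim v l.
Proof.
  intros H. apply is_lim_seq_ext_loc. exists N. intros n Hn; now rewrite H.
Qed.

Fixpoint csum (n : nat) (f : nat -> C) : C :=
  match n with O => RtoC 0 | S k => csum k f + f k end.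

Lemma csum_ext (n : nat) (f g : nat -> C) :
  (forall j, (j < n)%nat -> f j = g j) -> csum n f = csum n g.
Proof.
  induction n as [|n IH]; intros H; simpl; auto.
  rewrite IH, (H n); auto with arith.
Qed.

Lemma csum_plus (n : nat) (f g : nat -> C) :
  csum n (fun j => f j + g j) = csum n f + csum n g.
Proof. induction n as [|n IH]; simpl; [|rewrite IH]; ring. Qed.

Lemma csum_scal (n : nat) (c : C) (f : nat -> C) :
  csum n (fun j => c * f j) = c * csum n f.
Proof. induction n as [|n IH]; simpl; [|rewrite IH]; ring. Qed.

Lemma csum_head (n : nat) (f : nat -> C) :
  csum (S n) f = f O + csum n (fun j => f (S j)).
Proof.
  induction n as [|n IH]; [simpl; ring|].
  change (csum (S (S n)) f) with (csum (S n) f + f (S n)).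
  rewrite IH; simpl; ring.
Qed.

Lemma csum_add (m n : nat) (f : nat -> C) :
  csum (m + n) f = csum m f + csum n (fun j => f (m + j)%nat).
Proof.
  induction n as [|n IH]; [rewrite Nat.add_0_r; simpl; ring|].
  rewrite Nat.add_succ_r; simpl; rewrite IH; ring.
Qed.

Lemma csum_rev (n : nat) (f : nat -> C) :
  csum n f = csum n (fun j => f (n - 1 - j)%nat).
Proof.
  induction n as [|n IH]; [reflexivity|].
  rewrite (csum_head n (fun j => f (S n - 1 - j)%nat)).
  change (csum (S n) f) with (csum n f + f n). rewrite IH, Cplus_comm.
  f_equal; [f_equal; lia|]. apply csum_ext; intros; f_equal; lia.
Qed.

Lemma clim_csum (f : nat -> nat -> C) (g : nat -> C) (m : nat) :
  (forall j, clim (fun n => f n j) (g j)) ->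
  clim (fun n => csum m (f n)) (csum m g).
Proof.
  intros H. induction m as [|m IH]; simpl; [apply clim_const|].
  now apply clim_plus.
Qed.

Lemma is_series_clim (f : nat -> C) (l : C) :
  clim (fun n => csum n f) l -> is_series f l.
Proof.
  intros H. apply clim_filterlim.
  (* The partial sums behind [is_series] include their last index while [csum n] stops before n;
     hence the shift by [S]. *)
  apply clim_ext with (fun n => csum (S n) f).
  - intros n; induction n as [|n IH]; [rewrite sum_O; simpl; ring|].
    rewrite sum_Sn, <- IH. reflexivity.
  - apply (clim_subseq (fun n => csum n f) l S); auto.
    intros N; exists N; lia.
Qed.

Lemma csum_tail_le (f : nat -> C) (K p : R) (m n : nat) :
  (0 <= p < 1)%R -> (forall j, Cmod (f j) <= K * p ^ j)%R ->
  (Cmod (csum (m + n) f - csum m f) <= K * p ^ m / (1 - p))%R.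
Proof.
  intros Hp Hf.
  assert (HK : (0 <= K)%R)
    by (specialize (Hf O); simpl in Hf; assert (H := Cmod_ge_0 (f O)); lra).
  assert (H : (Cmod (csum (m + n) f - csum m f) <= K * p ^ m * (1 - p ^ n) / (1 - p))%R).
  { induction n as [|n IH].
    - rewrite Nat.add_0_r. replace (csum m f - csum m f) with (RtoC 0) by ring.
      rewrite Cmod_0; simpl. right; field; lra.
    - rewrite Nat.add_succ_r; simpl csum.
      replace (csum (m + n) f + f (m + n)%nat - csum m f)
        with ((csum (m + n) f - csum m f) + f (m + n)%nat) by ring.
      eapply Rle_trans; [apply Cmod_triangle|].
      eapply Rle_trans; [apply Rplus_le_compat; [apply IH|apply Hf]|].
      rewrite pow_add; simpl. right; field; lra. }
  eapply Rle_trans; [apply H|]. apply Rmult_le_compat_r.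
  - apply Rlt_le, Rinv_0_lt_compat; lra.
  - assert (0 <= p ^ n)%R by (apply pow_le; lra).
    assert (0 <= K * p ^ m)%R by (apply Rmult_le_pos; auto; apply pow_le; lra). nra.
Qed.

(** Built from the total real [Series], so it names a value at once; it is the sum whenever a
    geometric bound holds, by [cseries_geom_cv]. *)
Definition cseries (f : nat -> C) : C :=
  (Series (fun n => Re (f n)), Series (fun n => Im (f n))).

Lemma cseries_geom_cv (f : nat -> C) (K p : R) :
  (0 <= p < 1)%R -> (forall j, Cmod (f j) <= K * p ^ j)%R ->
  clim (fun n => csum n f) (cseries f).
Proof.
  intros Hp Hf.
  assert (Hg : ex_series (fun n => (K * p ^ n)%R)).
  { apply (ex_series_scal_l K (fun n => (p ^ n)%R)), ex_series_geom.
    rewrite Rabs_pos_eq; lra. }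
  assert (cv : forall c : C -> R, (forall z, Rabs (c z) <= Cmod z)%R ->
     (forall y z : C, c (y + z)%C = (c y + c z)%R) -> c (RtoC 0) = 0%R ->
     is_lim_seq (fun n => c (csum n f)) (Series (fun n => c (f n)))).
  { intros c Hc Hadd H0.
    assert (Hl : ex_series (fun n => c (f n))).
    { apply (ex_series_le (fun n => c (f n)) (fun n => (K * p ^ n)%R)); auto.
      intros n. eapply Rle_trans; [apply Hc | apply Hf]. }
    apply is_lim_seq_incr_1.
    apply is_lim_seq_ext with (2 := Series_correct _ Hl).
    intros n; induction n as [|n IH].
    - rewrite sum_O. simpl. rewrite Hadd, H0. symmetry; apply Rplus_0_l.
    - rewrite sum_Sn, IH. simpl. now rewrite !Hadd. }
  assert (H1 := cv Re re_le_Cmod (fun y z => eq_refl) eq_refl).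
  assert (H2 := cv Im
    (fun z => Rle_trans _ _ _ (Rmax_r (Rabs (fst z)) (Rabs (snd z))) (Rmax_Cmod z))
    (fun y z => eq_refl) eq_refl).
  unfold cseries. revert H1 H2.
  generalize (Series (fun n => Re (f n))) (Series (fun n => Im (f n))).
  intros l1 l2 H1 H2.
  apply clim_le with (e := fun n => (sqrt 2 * (Rabs (Re (csum n f) - l1) + Rabs (Im (csum n f) - l2)))%R).
  - intros n. eapply Rle_trans; [apply Cmod_2Rmax|].
    apply Rmult_le_compat_l; [apply sqrt_pos|].
    change (fst (csum n f - (l1, l2))) with (Re (csum n f) - l1)%R.
    change (snd (csum n f - (l1, l2))) with (Im (csum n f) - l2)%R.
    apply Rmax_lub;
      [assert (H := Rabs_pos (Im (csum n f) - l2)) | assert (H := Rabs_pos (Re (csum n f) - l1))];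
      lra.
  - assert (E : forall u l, is_lim_seq u (Finite l) ->
        is_lim_seq (fun n => Rabs (u n - l)) 0%R).
    { intros u l Hu.
      replace (Finite 0) with (Rbar_abs (Finite (l - l))) by (simpl; f_equal; rewrite Rminus_diag; apply Rabs_R0).
      apply is_lim_seq_abs, is_lim_seq_minus'; auto using is_lim_seq_const. }
    replace (Finite 0) with (Finite (sqrt 2 * (0 + 0))) by (f_equal; ring).
    apply is_lim_seq_mult'; auto using is_lim_seq_const.
    apply is_lim_seq_plus'; auto.
Qed.

Lemma csum_lim_tail_le (f : nat -> C) (K p : R) (l : C) (m : nat) :
  (0 <= p < 1)%R -> (forall j, Cmod (f j) <= K * p ^ j)%R ->
  clim (fun n => csum n f) l ->
  (Cmod (l - csum m f) <= K * p ^ m / (1 - p))%R.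
Proof.
  intros Hp Hf Hl.
  apply clim_dist_le with (fun n => csum (m + n) f).
  - intros n; now apply csum_tail_le.
  - apply (clim_subseq (fun n => csum n f) l (fun n => m + n)%nat); auto.
    intros N; exists N; lia.
Qed.

Lemma is_lim_seq_geom_scal (K p : R) :
  (0 <= p < 1)%R -> is_lim_seq (fun n => (K * p ^ n)%R) 0%R.
Proof.
  intros Hp. replace (Finite 0) with (Finite (K * 0)) by (f_equal; ring).
  apply is_lim_seq_mult'; auto using is_lim_seq_const.
  apply is_lim_seq_geom. rewrite Rabs_pos_eq; lra.
Qed.

(** Dominated convergence for a triangular array. Cut at an index m: the head converges termwise,
    and the tails of both sides are at most K' K p^m / (1 - p). *)
Lemma tannery (w : nat -> nat -> C) (w0 : C) (c : nat -> C) (s : C) (K K' p : R) :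
  (0 <= p < 1)%R -> (forall j, Cmod (c j) <= K * p ^ j)%R ->
  (forall n j, (j <= n)%nat -> Cmod (w n j) <= K')%R ->
  (forall j, clim (fun n => w n j) w0) ->
  clim (fun n => csum n c) s ->
  clim (fun n => csum n (fun j => w n j * c j)) (w0 * s).
Proof.
  intros Hp Hc Hw Hlim Hs.
  assert (HK : (0 <= K)%R)
    by (specialize (Hc O); simpl in Hc; assert (H := Cmod_ge_0 (c O)); lra).
  assert (HK' : (0 <= K')%R)
    by (eapply Rle_trans; [apply Cmod_ge_0 | apply (Hw O O); lia]).
  (* Large enough for the two tail bounds together. *)
  set (B := (2 * (K' * (K / (1 - p))) + 1)%R).
  assert (HB0 : (0 <= K' * (K / (1 - p)))%R).
  { apply Rmult_le_pos; auto. apply Rmult_le_pos; auto.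
    apply Rlt_le, Rinv_0_lt_compat; lra. }
  assert (HB : (0 < B)%R) by (unfold B; lra).
  assert (Hw0 : (Cmod w0 <= K')%R).
  { apply clim_mod_le with (fun n => w n O); auto. intros; apply Hw; lia. }
  apply is_lim_seq_spec. intros eps.
  assert (He : (0 < eps / 2)%R) by (destruct eps; simpl; lra).
  destruct (proj2 (is_lim_seq_spec _ _) (is_lim_seq_geom_scal B p Hp)
              (mkposreal _ He)) as [m Hm].
  specialize (Hm m (le_n m)). simpl in Hm.
  assert (Hhead : clim (fun n => csum m (fun j => w n j * c j)) (w0 * csum m c)).
  { rewrite <- csum_scal. apply clim_csum. intros j.
    apply clim_mult; auto using clim_const. }
  destruct (proj2 (is_lim_seq_spec _ _) Hhead
              (mkposreal _ He)) as [N HN].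
  exists (N + m)%nat. intros n Hn.
  assert (HNn := HN n ltac:(lia)). simpl in HNn.
  rewrite Rminus_0_r, Rabs_pos_eq in Hm, HNn |- *;
    try apply Cmod_ge_0; try (apply Rmult_le_pos; [|apply pow_le]; lra).
  replace n with (m + (n - m))%nat at 1 by lia.
  set (k := (n - m)%nat).
  rewrite csum_add.
  replace (csum m (fun j => w n j * c j) + csum k (fun j => w n (m + j)%nat * c (m + j)%nat) - w0 * s)
    with ((csum m (fun j => w n j * c j) - w0 * csum m c) +
          (csum k (fun j => w n (m + j)%nat * c (m + j)%nat) + - (w0 * (s - csum m c)))) by ring.
  eapply Rle_lt_trans; [apply Cmod_triangle|].
  apply Rlt_le_trans with (eps / 2 + eps / 2)%R; [|right; field].
  apply Rplus_lt_compat; auto.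
  eapply Rle_lt_trans; [apply Cmod_triangle|].
  eapply Rle_lt_trans; [|apply Hm].
  assert (Hpm : (0 <= p ^ m)%R) by (apply pow_le; lra).
  apply Rle_trans with (K' * (K / (1 - p)) * p ^ m + K' * (K / (1 - p)) * p ^ m)%R;
    [|unfold B; lra].
  apply Rplus_le_compat.
  (* The weights are bounded only for j <= n, whereas [csum_tail_le] asks for a bound at every
     index; cutting off at n does not change the sum. *)
  - set (f := fun j => if (j <=? n)%nat then w n j * c j else 0).
    replace (csum k (fun j => w n (m + j)%nat * c (m + j)%nat))
      with (csum (m + k) f - csum m f).
    2:{ rewrite csum_add.
        rewrite (csum_ext k (fun j => f (m + j)%nat) (fun j => w n (m + j)%nat * c (m + j)%nat)).
        { ring. }
        intros j Hj. unfold f. destruct (Nat.leb_spec (m + j) n); auto. lia. }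
    eapply Rle_trans; [apply (csum_tail_le f (K' * K)%R p m k Hp)|].
    + intros j. unfold f. destruct (Nat.leb_spec j n).
      * rewrite Cmod_mult, Rmult_assoc. apply Rmult_le_compat; auto using Cmod_ge_0.
      * rewrite Cmod_0. apply Rmult_le_pos; [nra | apply pow_le; lra].
    + right; field; lra.
  - rewrite Cmod_opp, Cmod_mult, Rmult_assoc.
    apply Rmult_le_compat; auto using Cmod_ge_0.
    eapply Rle_trans; [apply (csum_lim_tail_le c K p s m Hp Hc Hs)|].
    right; field; lra.
Qed.

(** * q-Pochhammer symbols and the Jacobi triple product *)

Lemma pow_n_Cpow (z : C) (n : nat) : pow_n z n = z ^ n.
Proof. induction n as [|n IH]; simpl; [|rewrite IH]; reflexivity. Qed.

Lemma cprod_ext (n : nat) (f g : nat -> C) :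
  (forall j, (j < n)%nat -> f j = g j) -> cprod n f = cprod n g.
Proof.
  induction n as [|n IH]; intros H; simpl; auto.
  rewrite IH, (H n); auto with arith.
Qed.

Lemma cprod_add (m n : nat) (f : nat -> C) :
  cprod (m + n) f = cprod m f * cprod n (fun j => f (m + j)%nat).
Proof.
  induction n as [|n IH]; [rewrite Nat.add_0_r; simpl; ring|].
  rewrite Nat.add_succ_r; simpl; rewrite IH; ring.
Qed.

Lemma cprod_scal (n : nat) (c : C) (f : nat -> C) :
  cprod n (fun j => c * f j) = c ^ n * cprod n f.
Proof. induction n as [|n IH]; simpl; [|rewrite IH]; ring. Qed.

Lemma qpoch_Cpow (a Q : C) (n : nat) : qpoch a Q n = cprod n (fun j => 1 - a * Q ^ j).
Proof. apply cprod_ext. intros j _. now rewrite (pow_n_Cpow Q j). Qed.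

Lemma qpoch_S (a Q : C) (n : nat) : qpoch a Q (S n) = qpoch a Q n * (1 - a * Q ^ n).
Proof. unfold qpoch; simpl. now rewrite pow_n_Cpow. Qed.

Lemma qpoch_add (a Q : C) (m n : nat) :
  qpoch a Q (m + n) = qpoch a Q m * qpoch (a * Q ^ m) Q n.
Proof.
  rewrite !qpoch_Cpow, cprod_add. f_equal. apply cprod_ext. intros j _.
  rewrite Cpow_add_r; ring.
Qed.

Lemma qpoch_head (a Q : C) (n : nat) : qpoch a Q (S n) = (1 - a) * qpoch (a * Q) Q n.
Proof.
  change (S n) with (1 + n)%nat. rewrite qpoch_add, qpoch_S.
  replace (a * Q ^ 1) with (a * Q) by ring. unfold qpoch at 1; simpl; ring.
Qed.

(** Each factor has modulus at most 1 + |Q|^j <= exp (|Q|^j), and the exponents form a geometric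
    sum. *)
Lemma qpoch_le (a Q : C) (n : nat) :
  (Cmod a <= 1)%R -> (Cmod Q < 1)%R -> (Cmod (qpoch a Q n) <= exp (/ (1 - Cmod Q)))%R.
Proof.
  intros Ha HQ. assert (HQ0 := Cmod_ge_0 Q).
  assert (H : (Cmod (qpoch a Q n) <= exp ((1 - Cmod Q ^ n) / (1 - Cmod Q)))%R).
  { induction n as [|n IH].
    - unfold qpoch; simpl. rewrite Cmod_1, Rminus_diag. unfold Rdiv.
      rewrite Rmult_0_l, exp_0; lra.
    - rewrite qpoch_S, Cmod_mult.
      replace ((1 - Cmod Q ^ S n) / (1 - Cmod Q))%R
        with ((1 - Cmod Q ^ n) / (1 - Cmod Q) + Cmod Q ^ n)%R by (simpl; field; lra).
      rewrite exp_plus. apply Rmult_le_compat; auto using Cmod_ge_0.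
      eapply Rle_trans; [apply Cmod_triangle|].
      rewrite Cmod_opp, Cmod_mult, Cmod_pow, Cmod_1.
      eapply Rle_trans; [|apply exp_ineq1_le].
      assert (0 <= Cmod Q ^ n)%R by (apply pow_le; lra). nra. }
  eapply Rle_trans; [apply H|]. assert (0 <= Cmod Q ^ n)%R by (apply pow_le; lra).
  assert (0 < / (1 - Cmod Q))%R by (apply Rinv_0_lt_compat; lra).
  destruct (Rle_lt_or_eq_dec ((1 - Cmod Q ^ n) / (1 - Cmod Q)) (/ (1 - Cmod Q))) as [L|E].
  - unfold Rdiv. nra.
  - now apply Rlt_le, exp_increasing.
  - rewrite E; lra.
Qed.

(** With x = |a| |Q|^j, the identity 1/(1 - x) = 1 + x/(1 - x) <= exp (x/(1 - x)) bounds each factor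
    below, and x/(1 - x) <= c |Q|^j for c = |a|/(1 - |a|). *)
Lemma qpoch_ge (a Q : C) :
  (Cmod a < 1)%R -> (Cmod Q < 1)%R ->
  exists m, (0 < m)%R /\ forall n, (m <= Cmod (qpoch a Q n))%R.
Proof.
  intros Ha HQ. assert (HQ0 := Cmod_ge_0 Q). assert (Ha0 := Cmod_ge_0 a).
  set (c := (Cmod a / (1 - Cmod a))%R).
  assert (Hc : (0 <= c)%R)
    by (apply Rmult_le_pos; [|apply Rlt_le, Rinv_0_lt_compat]; lra).
  exists (exp (- (c / (1 - Cmod Q)))). split; [apply exp_pos|]. intros n.
  assert (H : (exp (- (c * (1 - Cmod Q ^ n) / (1 - Cmod Q))) <= Cmod (qpoch a Q n))%R).
  { induction n as [|n IH].
    - unfold qpoch; simpl. rewrite Cmod_1, Rminus_diag. unfold Rdiv.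
      rewrite Rmult_0_r, Rmult_0_l, Ropp_0, exp_0; lra.
    - rewrite qpoch_S, Cmod_mult.
      replace (- (c * (1 - Cmod Q ^ S n) / (1 - Cmod Q)))%R
        with (- (c * (1 - Cmod Q ^ n) / (1 - Cmod Q)) + - (c * Cmod Q ^ n))%R
        by (simpl; field; lra).
      rewrite exp_plus. apply Rmult_le_compat; auto using Rlt_le, exp_pos.
      assert (Hp : (0 <= Cmod Q ^ n <= 1)%R).
      { split; [apply pow_le; lra|]. rewrite <- (pow1 n). apply pow_incr; lra. }
      set (x := (Cmod a * Cmod Q ^ n)%R).
      assert (Hx : (0 <= x <= Cmod a)%R) by (unfold x; nra).
      apply Rle_trans with (1 - x)%R.
      + rewrite exp_Ropp, <- (Rinv_inv (1 - x)).
        apply Rinv_le_contravar; [apply Rinv_0_lt_compat; lra|].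
        eapply Rle_trans; [|apply exp_ineq1_le].
        replace (/ (1 - x))%R with (1 + x / (1 - x))%R by (field; lra).
        apply Rplus_le_compat_l. unfold c.
        replace (Cmod a / (1 - Cmod a) * Cmod Q ^ n)%R with (x / (1 - Cmod a))%R
          by (unfold x; field; lra).
        apply Rmult_le_compat_l; [lra|]. apply Rinv_le_contravar; lra.
      + replace x with (Cmod (a * Q ^ n)) by (rewrite Cmod_mult, Cmod_pow; reflexivity).
        assert (T := Cmod_triangle (1 - a * Q ^ n) (a * Q ^ n)).
        replace (1 - a * Q ^ n + a * Q ^ n) with (RtoC 1) in T by ring.
        rewrite Cmod_1 in T. lra. }
  eapply Rle_trans; [|apply H]. assert (0 <= Cmod Q ^ n)%R by (apply pow_le; lra).
  assert (0 < / (1 - Cmod Q))%R by (apply Rinv_0_lt_compat; lra).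
  assert (L : (- (c / (1 - Cmod Q)) <= - (c * (1 - Cmod Q ^ n) / (1 - Cmod Q)))%R).
  { apply Ropp_le_contravar. unfold Rdiv. apply Rmult_le_compat_r; nra. }
  destruct L as [L|E]; [now apply Rlt_le, exp_increasing | rewrite E; lra].
Qed.

Lemma qpoch_neq_0 (a Q : C) (n : nat) :
  (Cmod a < 1)%R -> (Cmod Q < 1)%R -> qpoch a Q n <> 0.
Proof.
  intros Ha HQ. destruct (qpoch_ge a Q Ha HQ) as [m [Hm H]].
  apply Cmod_gt_0. specialize (H n); lra.
Qed.

(** The increments -(a;Q)_n a Q^n are geometrically dominated, so the product converges as a series;
    the uniform lower bound keeps the limit away from 0. *)
Lemma qpoch_cv (a Q : C) :
  (Cmod a < 1)%R -> (Cmod Q < 1)%R ->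
  exists P, clim (fun n => qpoch a Q n) P /\ P <> 0.
Proof.
  intros Ha HQ. assert (HQ0 := Cmod_ge_0 Q). assert (Ha0 := Cmod_ge_0 a).
  set (f := fun n => - (qpoch a Q n * a * Q ^ n)).
  assert (Hl : clim (fun n => csum n f) (cseries f)).
  { apply cseries_geom_cv with (exp (/ (1 - Cmod Q))) (Cmod Q); [lra|].
    intros j. unfold f. rewrite Cmod_opp, !Cmod_mult, Cmod_pow.
    apply Rmult_le_compat_r; [apply pow_le; lra|].
    assert (H := qpoch_le a Q j (Rlt_le _ _ Ha) HQ).
    assert (H0 := Cmod_ge_0 (qpoch a Q j)). nra. }
  exists (1 + cseries f).
  assert (H : clim (fun n => qpoch a Q n) (1 + cseries f)).
  { apply clim_ext with (fun n => 1 + csum n f).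
    - induction n as [|n IH]; [unfold qpoch; simpl; ring|].
      rewrite qpoch_S, <- IH. simpl csum. unfold f at 2. rewrite <- IH; ring.
    - apply clim_plus; auto using clim_const. }
  split; auto. destruct (qpoch_ge a Q Ha HQ) as [m [Hm Hge]].
  apply Cmod_gt_0. assert (M := clim_mod_ge _ _ _ Hge H). lra.
Qed.

(** * Gaussian binomials and the finite triple product *)

Fixpoint qbin (Q : C) (N j : nat) : C :=
  match N, j with
  | _, O => 1
  | O, S _ => 0
  | S N', S j' => Q ^ j * qbin Q N' j + qbin Q N' j'
  end.

Lemma qbin_0_r (Q : C) (N : nat) : qbin Q N 0 = 1.
Proof. now destruct N. Qed.

Lemma qbin_SS (Q : C) (N j : nat) :
  qbin Q (S N) (S j) = Q ^ (S j) * qbin Q N (S j) + qbin Q N j.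
Proof. reflexivity. Qed.

Lemma qbin_gt (Q : C) (N j : nat) : (N < j)%nat -> qbin Q N j = 0.
Proof.
  revert j; induction N as [|N IH]; intros [|j] H; try lia; [reflexivity|].
  rewrite qbin_SS, !IH by lia. ring.
Qed.

Lemma qbin_qpoch (Q : C) (i j : nat) :
  qbin Q (i + j) j * qpoch Q Q i * qpoch Q Q j = qpoch Q Q (i + j).
Proof.
  remember (i + j)%nat as N eqn:E. revert i j E.
  induction N as [|N IH]; intros i j E.
  - replace i with O by lia. replace j with O by lia. unfold qpoch; simpl; ring.
  - destruct j as [|j].
    + rewrite qbin_0_r. replace i with (S N) by lia. unfold qpoch at 2; simpl cprod; ring.
    + rewrite qbin_SS. destruct i as [|i].
      * rewrite qbin_gt by lia. specialize (IH O j ltac:(lia)).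
        replace (S N) with (S j) by lia. rewrite (qpoch_S Q Q j).
        replace N with j in * by lia.
        transitivity (qbin Q j j * qpoch Q Q 0 * qpoch Q Q j * (1 - Q * Q ^ j)); [ring|].
        now rewrite IH.
      * assert (H1 := IH i (S j) ltac:(lia)). assert (H2 := IH (S i) j ltac:(lia)).
        transitivity (Q ^ S j * (1 - Q * Q ^ i) * (qbin Q N (S j) * qpoch Q Q i * qpoch Q Q (S j))
          + (1 - Q * Q ^ j) * (qbin Q N j * qpoch Q Q (S i) * qpoch Q Q j)).
        { rewrite (qpoch_S Q Q i), (qpoch_S Q Q j). ring. }
        rewrite H1, H2, (qpoch_S Q Q N). replace N with (i + S j)%nat by lia.
        rewrite Cpow_add_r. simpl. ring.
Qed.

(** The binomial coefficient n(n - 1)/2, free of division. *)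
Fixpoint tri (n : nat) : nat :=
  match n with O => O | S k => (tri k + k)%nat end.

Lemma tri_add (m n : nat) : tri (m + n) = (tri m + tri n + m * n)%nat.
Proof.
  induction n as [|n IH]; [rewrite Nat.add_0_r, Nat.mul_0_r; simpl; lia|].
  rewrite Nat.add_succ_r, Nat.mul_succ_r; simpl; lia.
Qed.

Lemma tri_double (n : nat) : (2 * tri n + n = n * n)%nat.
Proof. induction n as [|n IH]; simpl; lia. Qed.

(** Homogeneous in x and y, so that y = Q^n can later centre the sum without negative powers. The
    induction splits off the factor j = 0, which replaces x by xQ in the others; the two resulting
    sums recombine by the Pascal rule. *)
Lemma q_binomial (Q x y : C) (N : nat) :
  cprod N (fun j => y - x * Q ^ j) =
  csum (S N) (fun j => qbin Q N j * Q ^ tri j * (- x) ^ j * y ^ (N - j)).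
Proof.
  revert x. induction N as [|N IH]; intros x; [simpl; ring|].
  change (S N) with (1 + N)%nat at 1. rewrite cprod_add.
  rewrite (cprod_ext N _ (fun j => y - x * Q * Q ^ j)) by (intros; simpl; ring).
  rewrite IH. simpl cprod.
  set (A := fun j => Q ^ j * qbin Q N j * Q ^ tri j * (- x) ^ j * y ^ (S N - j)).
  set (B := fun j => qbin Q N j * Q ^ tri (S j) * (- x) ^ S j * y ^ (N - j)).
  transitivity (csum (S N) A + csum (S N) B).
  - rewrite <- csum_plus, <- csum_scal. apply csum_ext. intros j Hj.
    unfold A, B. rewrite Nat.sub_succ_l by lia. simpl tri. rewrite Cpow_add_r.
    replace (- (x * Q)) with ((- x) * Q) by ring. rewrite Cpow_mult_l. simpl. ring.
  - rewrite (csum_head (S N)), qbin_0_r.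
    assert (A0 : A (S N) = 0) by (unfold A; rewrite qbin_gt by lia; ring).
    replace (csum (S N) A) with (csum (S (S N)) A)
      by (change (csum (S (S N)) A) with (csum (S N) A + A (S N)); rewrite A0; ring).
    rewrite csum_head. unfold A at 1. rewrite qbin_0_r.
    rewrite (csum_ext (S N) (fun j => qbin Q (S N) (S j) * _ * _ * _) (fun j => A (S j) + B j)).
    + rewrite csum_plus. simpl (Q ^ 0). ring.
    + intros j Hj. rewrite qbin_SS. unfold A, B. rewrite !Nat.sub_succ. ring.
Qed.

(** Since ab = Q, each factor is -a Q^j (1 - b Q^(n-1-j)): the lower half of the centred product
    turns into a Pochhammer symbol in b. *)
Lemma cprod_reflect (Q a b : C) (n : nat) :
  a * b = Q ->
  cprod n (fun j => Q ^ n - a * Q ^ j) = (- a) ^ n * Q ^ tri n * qpoch b Q n.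
Proof.
  intros Hab. induction n as [|n IH]; [unfold qpoch; simpl; ring|].
  change (S n) with (1 + n)%nat at 1. rewrite cprod_add.
  rewrite (cprod_ext n _ (fun j => Q * (Q ^ n - a * Q ^ j))) by (intros; simpl; ring).
  rewrite cprod_scal, IH, qpoch_S. simpl. rewrite Cpow_add_r, <- Hab. ring.
Qed.

Lemma finite_triple_product (Q a b : C) (n : nat) :
  a * b = Q -> Q <> 0 ->
  qpoch a Q n * qpoch b Q n =
  csum (S n) (fun k => qbin Q (n + n) (n + k) * (Q ^ tri k * (- a) ^ k)) +
  csum n (fun k => qbin Q (n + n) (n - S k) * (Q ^ tri (S k) * (- b) ^ S k)).
Proof.
  intros Hab HQ.
  assert (Ha : a <> 0) by (intros E; apply HQ; rewrite <- Hab, E; ring).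
  (* The monomial common to the 2n factors Q^n - a Q^j: the first n contribute (-a)^n Q^(tri n), the
     last n contribute Q^(n n). *)
  set (D := Q ^ (n * n + tri n) * (- a) ^ n).
  assert (HD : D <> 0).
  { apply Cmult_neq_0; apply Cpow_nz; auto.
    intros E. apply Ha. replace a with (- - a) by ring. rewrite E; ring. }
  assert (H := q_binomial Q a (Q ^ n) (n + n)).
  rewrite cprod_add, (cprod_reflect Q a b n Hab) in H.
  rewrite (cprod_ext n (fun j => Q ^ n - a * Q ^ (n + j)) (fun j => Q ^ n * (1 - a * Q ^ j))) in H
    by (intros; rewrite Cpow_add_r; ring).
  rewrite cprod_scal in H.
  rewrite <- qpoch_Cpow in H.
  rewrite <- Nat.add_succ_r, csum_add in H.
  rewrite (csum_rev n) in H.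
  assert (E : D * (qpoch a Q n * qpoch b Q n) =
    D * (csum (S n) (fun k => qbin Q (n + n) (n + k) * (Q ^ tri k * (- a) ^ k)) +
  csum n (fun k => qbin Q (n + n) (n - S k) * (Q ^ tri (S k) * (- b) ^ S k)))).
  { transitivity ((- a) ^ n * Q ^ tri n * qpoch b Q n * ((Q ^ n) ^ n * qpoch a Q n)).
    { unfold D. rewrite Cpow_add_r, Cpow_mult_r. ring. }
    rewrite H. rewrite Cplus_comm, Cmult_plus_distr_l, <- !csum_scal. f_equal.
    - apply csum_ext. intros k Hk. unfold D.
      assert (P : Q ^ tri (n + k) * (Q ^ n) ^ (n + n - (n + k)) = Q ^ (n * n + tri n) * Q ^ tri k).
      { rewrite <- Cpow_mult_r, <- !Cpow_add_r. f_equal. rewrite tri_add.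
        replace (n + n - (n + k))%nat with (n - k)%nat by lia.
        rewrite Nat.mul_sub_distr_l.
        assert (n * k <= n * n)%nat by (apply Nat.mul_le_mono_l; lia). lia. }
      rewrite (Cpow_add_r (- a)).
      transitivity (qbin Q (n + n) (n + k) * ((- a) ^ n * (- a) ^ k) *
        (Q ^ tri (n + k) * (Q ^ n) ^ (n + n - (n + k)))); [ring|]. rewrite P. ring.
    - apply csum_ext. intros k Hk. unfold D.
      replace (n - 1 - k)%nat with (n - S k)%nat by lia.
      set (m := (n - S k)%nat). set (l := S k).
      assert (Em : n = (m + l)%nat) by (unfold m, l; lia).
      assert (P : Q ^ tri m * (Q ^ n) ^ (n + n - m) = Q ^ (n * n + tri n) * Q ^ tri l * Q ^ l).
      { rewrite <- Cpow_mult_r, <- !Cpow_add_r. f_equal.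
        assert (T1 := tri_add m l). assert (T2 := tri_double l).
        rewrite <- Em in T1. replace (n + n - m)%nat with (n + l)%nat by lia.
        rewrite Nat.mul_add_distr_l. replace (n * l)%nat with (m * l + l * l)%nat by (rewrite Em; ring).
        lia. }
      (* Below the centre the powers of a fall short of n; ab = Q trades the missing ones for powers
         of b. *)
      assert (PA : (- a) ^ n * (- b) ^ l = (- a) ^ m * Q ^ l).
      { rewrite Em, Cpow_add_r, <- Cmult_assoc, <- Cpow_mult_l.
        replace (- a * - b) with Q by (rewrite <- Hab; ring). reflexivity. }
      transitivity (qbin Q (n + n) m * (- a) ^ m * (Q ^ tri m * (Q ^ n) ^ (n + n - m))); [ring|].
      rewrite P.
      transitivity (qbin Q (n + n) m * Q ^ (n * n + tri n) * Q ^ tri l * ((- a) ^ m * Q ^ l)); [ring|].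
      rewrite <- PA. ring. }
  apply (f_equal (fun z => / D * z)) in E.
  rewrite !Cmult_assoc, Cinv_l, !Cmult_1_l in E; auto.
Qed.

Lemma qbin_eq (Q : C) (i j : nat) :
  (Cmod Q < 1)%R ->
  qbin Q (i + j) j = qpoch Q Q (i + j) * (/ qpoch Q Q i * / qpoch Q Q j).
Proof.
  intros HQ. rewrite <- qbin_qpoch. field.
  split; apply qpoch_neq_0; auto.
Qed.

Lemma qbin_bounded (Q : C) :
  (Cmod Q < 1)%R -> exists K, forall N j, (Cmod (qbin Q N j) <= K)%R.
Proof.
  intros HQ. destruct (qpoch_ge Q Q HQ HQ) as [m [Hm Hge]].
  exists (exp (/ (1 - Cmod Q)) * (/ m * / m))%R. intros N j.
  assert (0 < / m)%R by (apply Rinv_0_lt_compat; auto).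
  assert (HE := exp_pos (/ (1 - Cmod Q))).
  destruct (le_lt_dec j N) as [Hj|Hj].
  - replace N with ((N - j) + j)%nat by lia. rewrite qbin_eq, !Cmod_mult by auto.
    assert (I : forall n, (0 <= Cmod (/ qpoch Q Q n) <= / m)%R).
    { intros n. split; [apply Cmod_ge_0|].
      rewrite Cmod_inv by (apply qpoch_neq_0; auto). now apply Rinv_le_contravar. }
    destruct (I (N - j)%nat), (I j).
    apply Rmult_le_compat; try apply Cmod_ge_0.
    + apply Rmult_le_pos; auto.
    + apply qpoch_le; lra.
    + apply Rmult_le_compat; auto.
  - rewrite qbin_gt, Cmod_0 by auto. apply Rmult_le_pos; nra.
Qed.

Lemma qbin_lim (Q P : C) (phi psi : nat -> nat) :
  (Cmod Q < 1)%R -> clim (fun n => qpoch Q Q n) P -> P <> 0 ->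
  (forall N, exists N', forall n, (N' <= n)%nat -> (N <= phi n)%nat) ->
  (forall N, exists N', forall n, (N' <= n)%nat -> (N <= psi n)%nat) ->
  clim (fun n => qbin Q (phi n + psi n) (psi n)) (/ P).
Proof.
  intros HQ HP HP0 Hphi Hpsi.
  destruct (qpoch_ge Q Q HQ HQ) as [m [Hm Hge]].
  replace (/ P) with (P * (/ P * / P)) by (field; auto).
  apply clim_ext with (fun n => qpoch Q Q (phi n + psi n) * (/ qpoch Q Q (phi n) * / qpoch Q Q (psi n))).
  { intros n. symmetry. now apply qbin_eq. }
  apply clim_mult; [|apply clim_mult].
  - apply (clim_subseq (fun n => qpoch Q Q n) P (fun n => phi n + psi n)%nat); auto.
    intros N. destruct (Hphi N) as [N' H]. exists N'. intros n Hn. specialize (H n Hn); lia.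
  - apply (clim_subseq (fun n => / qpoch Q Q n) (/ P) phi); auto.
    now apply clim_inv with m.
  - apply (clim_subseq (fun n => / qpoch Q Q n) (/ P) psi); auto.
    now apply clim_inv with m.
Qed.

Lemma tri_term_le (Q x : C) (k : nat) :
  (Cmod Q < 1)%R -> (Cmod (Q ^ tri k * x ^ k) <= 1 * Cmod x ^ k)%R.
Proof.
  intros HQ. rewrite Cmod_mult, !Cmod_pow.
  apply Rmult_le_compat_r; [apply pow_le, Cmod_ge_0|].
  rewrite <- (pow1 (tri k)). apply pow_incr. split; [apply Cmod_ge_0 | lra].
Qed.

(** Tannery's theorem on the finite version: the Gaussian binomials are uniformly bounded weights,
    each tending to 1/P, and |a|, |b| < 1 already give geometric domination. *)
Lemma triple_product (Q a b A B P s t : C) :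
  a * b = Q -> Q <> 0 -> (Cmod a < 1)%R -> (Cmod b < 1)%R ->
  clim (fun n => qpoch a Q n) A -> clim (fun n => qpoch b Q n) B ->
  clim (fun n => qpoch Q Q n) P -> P <> 0 ->
  clim (fun n => csum n (fun k => Q ^ tri k * (- a) ^ k)) s ->
  clim (fun n => csum n (fun k => Q ^ tri (S k) * (- b) ^ S k)) t ->
  A * B * P = s + t.
Proof.
  intros Hab HQ0 Ha Hb HA HB HP HP0 Hs Ht.
  assert (Ha0 := Cmod_ge_0 a). assert (Hb0 := Cmod_ge_0 b).
  assert (HQ : (Cmod Q < 1)%R) by (rewrite <- Hab, Cmod_mult; nra).
  destruct (qbin_bounded Q HQ) as [K HK].
  (* The first finite sum has n + 1 terms, while [tannery] pairs index n with n terms; [pred]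
     realigns them until the subsequence along [S] is taken. *)
  assert (L1 : clim (fun n => csum n (fun k => qbin Q (pred n + pred n) (pred n + k) *
              (Q ^ tri k * (- a) ^ k))) (/ P * s)).
  { apply tannery with (K := 1%R) (p := Cmod a) (K' := K); auto.
    - intros j. rewrite <- (Cmod_opp a). now apply tri_term_le.
    - intros j. apply clim_ext_ge with (N := S j)
        (u := fun n => qbin Q ((pred n - j) + (pred n + j)) (pred n + j)).
      { intros n Hn. f_equal. lia. }
      apply (qbin_lim Q P (fun n => pred n - j)%nat (fun n => pred n + j)%nat); auto;
      intros N; exists (S (N + j))%nat; lia. }
  apply (clim_subseq _ _ S) in L1; [|intros N; exists N; lia]. simpl pred in L1.
  assert (L2 : clim (fun n => csum n (fun k => qbin Q (n + n) (n - S k) *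
              (Q ^ tri (S k) * (- b) ^ S k))) (/ P * t)).
  { apply tannery with (K := Cmod b) (p := Cmod b) (K' := K); auto.
    - intros j. eapply Rle_trans; [now apply tri_term_le|]. rewrite Cmod_opp. simpl. lra.
    - intros j. apply clim_ext_ge with (N := S j)
        (u := fun n => qbin Q ((n + S j) + (n - S j)) (n - S j)).
      { intros n Hn. f_equal. lia. }
      apply (qbin_lim Q P (fun n => n + S j)%nat (fun n => n - S j)%nat); auto;
      intros N; exists (S (N + j))%nat; lia. }
  assert (E : A * B = / P * s + / P * t).
  { apply clim_unique with (fun n => qpoch a Q n * qpoch b Q n).
    - now apply clim_mult.
    - eapply clim_ext; [|apply clim_plus; [apply L1 | apply L2]].
      intros n. symmetry. now apply finite_triple_product. }
  rewrite E. field; auto.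
Qed.

(** * Basic hypergeometric series *)

(** Coefficients of the basic hypergeometric series 2phi1 with upper parameters a, b and lower
    parameter 0. *)
Definition hyp_coef (a b Q : C) (n : nat) : C :=
  qpoch a Q n * qpoch b Q n / qpoch Q Q n.

Definition hyp (a b Q x : C) : C := cseries (fun n => hyp_coef a b Q n * x ^ n).

(** K is chosen before a and b because the iteration towards g_3 changes both parameters at every
    step. *)
Lemma hyp_coef_bounded (Q : C) :
  (Cmod Q < 1)%R ->
  exists K, (0 <= K)%R /\ forall a b n, (Cmod a <= 1)%R -> (Cmod b <= 1)%R ->
    (Cmod (hyp_coef a b Q n) <= K)%R.
Proof.
  intros HQ. destruct (qpoch_ge Q Q HQ HQ) as [m [Hm Hge]].
  set (E := exp (/ (1 - Cmod Q))).
  assert (HE : (0 < E)%R) by apply exp_pos.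
  assert (Hi : (0 < / m)%R) by (apply Rinv_0_lt_compat; auto).
  exists (E * E * / m)%R. split; [apply Rmult_le_pos; nra|].
  intros a b n Ha Hb. unfold hyp_coef, Cdiv. rewrite !Cmod_mult.
  apply Rmult_le_compat; try apply Cmod_ge_0.
  - apply Rmult_le_pos; apply Cmod_ge_0.
  - apply Rmult_le_compat; try apply Cmod_ge_0; now apply qpoch_le.
  - rewrite Cmod_inv by (apply qpoch_neq_0; auto). now apply Rinv_le_contravar.
Qed.

Lemma hyp_cv (a b Q x : C) :
  (Cmod Q < 1)%R -> (Cmod a <= 1)%R -> (Cmod b <= 1)%R -> (Cmod x < 1)%R ->
  clim (fun n => csum n (fun j => hyp_coef a b Q j * x ^ j)) (hyp a b Q x).
Proof.
  intros HQ Ha Hb Hx. destruct (hyp_coef_bounded Q HQ) as [K [HK H]].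
  apply cseries_geom_cv with K (Cmod x); [split; auto using Cmod_ge_0|].
  intros j. rewrite Cmod_mult, Cmod_pow.
  apply Rmult_le_compat_r; auto. apply pow_le, Cmod_ge_0.
Qed.

Lemma hyp_coef_S (a b Q : C) (n : nat) :
  (Cmod Q < 1)%R ->
  hyp_coef a b Q (S n) * (1 - Q ^ S n) =
  hyp_coef a b Q n * (1 - a * Q ^ n) * (1 - b * Q ^ n).
Proof.
  intros HQ. unfold hyp_coef.
  assert (H1 := qpoch_neq_0 Q Q n HQ HQ). assert (H2 := qpoch_neq_0 Q Q (S n) HQ HQ).
  rewrite qpoch_S in H2. rewrite !qpoch_S.
  replace (1 - Q ^ S n) with (1 - Q * Q ^ n) by (simpl; ring).
  field. split; auto. intros E. apply H2. rewrite E; ring.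
Qed.

(** The ratio of consecutive coefficients gives h(x) - h(xQ) = x (h(x) - (a + b) h(xQ) + ab
    h(xQ^2)), and ab = Q. For partial sums this holds up to one boundary term, which tends to 0. *)
Lemma hyp_contiguous (a b Q x : C) :
  a * b = Q -> (Cmod Q < 1)%R -> (Cmod a <= 1)%R -> (Cmod b <= 1)%R -> (Cmod x < 1)%R ->
  (1 - x) * hyp a b Q x =
  (1 - x * (a + b)) * hyp a b Q (x * Q) + x * Q * hyp a b Q (x * Q * Q).
Proof.
  intros Hab HQ Ha Hb Hx.
  assert (Hm : forall y, (Cmod y < 1)%R -> (Cmod (y * Q) < 1)%R).
  { intros y Hy. rewrite Cmod_mult. assert (H := Cmod_ge_0 y). assert (H' := Cmod_ge_0 Q). nra. }
  destruct (hyp_coef_bounded Q HQ) as [K [HK HKb]].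
  set (F := fun y N => csum N (fun j => hyp_coef a b Q j * y ^ j)).
  assert (Hfin : forall N, (1 - x) * F x N - ((1 - x * (a + b)) * F (x * Q) N + x * Q * F (x * Q * Q) N)
    = - (hyp_coef a b Q N * (1 - Q ^ N)) * x ^ N).
  { assert (HF : forall y N, F y (S N) = F y N + hyp_coef a b Q N * y ^ N) by reflexivity.
    induction N as [|N IH]; [unfold F; simpl; ring|].
    rewrite hyp_coef_S, !HF by auto.
    transitivity (((1 - x) * F x N - ((1 - x * (a + b)) * F (x * Q) N + x * Q * F (x * Q * Q) N))
      + ((1 - x) * (hyp_coef a b Q N * x ^ N)
         - ((1 - x * (a + b)) * (hyp_coef a b Q N * (x * Q) ^ N)
            + x * Q * (hyp_coef a b Q N * (x * Q * Q) ^ N)))); [ring|].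
    rewrite IH, !Cpow_mult_l, <- Hab. simpl. ring. }
  assert (L1 : clim (fun N => (1 - x) * F x N - ((1 - x * (a + b)) * F (x * Q) N + x * Q * F (x * Q * Q) N))
    ((1 - x) * hyp a b Q x - ((1 - x * (a + b)) * hyp a b Q (x * Q) + x * Q * hyp a b Q (x * Q * Q)))).
  { apply clim_minus; [|apply clim_plus]; apply clim_scal; apply hyp_cv; auto. }
  assert (L2 : clim (fun N => (1 - x) * F x N - ((1 - x * (a + b)) * F (x * Q) N + x * Q * F (x * Q * Q) N)) 0).
  { apply clim_ext with (1 := fun N => eq_sym (Hfin N)).
    apply clim_le with (e := fun n => (K * 2 * Cmod x ^ n)%R).
    - intros n. replace (- (hyp_coef a b Q n * (1 - Q ^ n)) * x ^ n - 0)
        with (- (hyp_coef a b Q n * (1 - Q ^ n) * x ^ n)) by ring.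
      rewrite Cmod_opp, !Cmod_mult, Cmod_pow.
      apply Rmult_le_compat_r; [apply pow_le, Cmod_ge_0|].
      apply Rmult_le_compat; auto using Cmod_ge_0.
      eapply Rle_trans; [apply Cmod_triangle|]. rewrite Cmod_opp, Cmod_pow, Cmod_1.
      assert (Cmod Q ^ n <= 1)%R.
      { rewrite <- (pow1 n). apply pow_incr. split; [apply Cmod_ge_0 | lra]. }
      lra.
    - apply is_lim_seq_geom_scal. split; auto using Cmod_ge_0. }
  assert (E := clim_unique _ _ _ L1 L2).
  set (u := (1 - x) * hyp a b Q x) in *.
  set (v := (1 - x * (a + b)) * hyp a b Q (x * Q) + x * Q * hyp a b Q (x * Q * Q)) in *.
  replace u with (u - v + v) by ring. rewrite E; ring.
Qed.

(* For [P = (Q;Q)_oo] the quotient [P / qpoch Q Q k] is [(x;Q)_oo] at [x = Q ^ (k + 1)]. *)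
Definition qsol (a b Q P : C) (k : nat) : C := P / qpoch Q Q k * hyp a b Q (Q ^ S k).

(** With x = Q^(k+1), the factorisation (x;Q)_oo = (1 - x)(xQ;Q)_oo cancels the 1 - x of
    [hyp_contiguous], and one more factor 1 - xQ appears in front of the last term. *)
Lemma qsol_rec (a b Q P : C) (k : nat) :
  a * b = Q -> (Cmod Q < 1)%R -> (Cmod a <= 1)%R -> (Cmod b <= 1)%R ->
  qsol a b Q P k =
  (1 - Q ^ S k * (a + b)) * qsol a b Q P (S k)
  + Q ^ S (S k) * (1 - Q ^ S (S k)) * qsol a b Q P (S (S k)).
Proof.
  intros Hab HQ Ha Hb. unfold qsol.
  assert (HQk : (Cmod (Q ^ S k) < 1)%R).
  { rewrite Cmod_pow. simpl. assert (H := Cmod_ge_0 Q).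
    assert (Cmod Q ^ k <= 1)%R by (rewrite <- (pow1 k); apply pow_incr; lra).
    assert (0 <= Cmod Q ^ k)%R by (apply pow_le; lra). nra. }
  assert (H := hyp_contiguous a b Q (Q ^ S k) Hab HQ Ha Hb HQk).
  replace (Q ^ S k * Q) with (Q ^ S (S k)) in H by (simpl; ring).
  replace (Q ^ S (S k) * Q) with (Q ^ S (S (S k))) in H by (simpl; ring).
  assert (N0 := qpoch_neq_0 Q Q k HQ HQ).
  assert (N1 := qpoch_neq_0 Q Q (S k) HQ HQ).
  assert (N2 := qpoch_neq_0 Q Q (S (S k)) HQ HQ).
  rewrite qpoch_S in N2. rewrite qpoch_S in N1, N2. rewrite !qpoch_S.
  change (Q * Q ^ k) with (Q ^ S k) in *. change (Q * Q ^ S k) with (Q ^ S (S k)) in *.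
  set (p := qpoch Q Q k) in *. set (y := Q ^ S k) in *. set (z := Q ^ S (S k)) in *.
  assert (Ny : 1 - y <> 0) by (intros E; apply N1; rewrite E; ring).
  assert (Nz : 1 - z <> 0) by (intros E; apply N2; rewrite E; ring).
  transitivity (P / (p * (1 - y)) * ((1 - y) * hyp a b Q y)); [field; auto|].
  rewrite H. field; auto.
Qed.

Lemma qsol_lim (a b Q P : C) :
  (Cmod Q < 1)%R -> (Cmod a <= 1)%R -> (Cmod b <= 1)%R ->
  clim (fun n => qpoch Q Q n) P -> P <> 0 ->
  clim (fun k => qsol a b Q P k) 1.
Proof.
  intros HQ Ha Hb HP HP0. unfold qsol. assert (HQ0 := Cmod_ge_0 Q).
  destruct (hyp_coef_bounded Q HQ) as [K [HK HKb]].
  destruct (qpoch_ge Q Q HQ HQ) as [m [Hm Hge]].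
  replace (RtoC 1) with (P * / P * 1) by (field; auto).
  apply clim_mult.
  - apply clim_scal. now apply clim_inv with m.
  - apply clim_le with (e := fun k => (K * Cmod Q / (1 - Cmod Q) * Cmod Q ^ k)%R).
    + intros k. set (x := Q ^ S k).
      assert (Hq : (0 <= Cmod Q ^ k <= 1)%R).
      { split; [apply pow_le; lra|]. rewrite <- (pow1 k); apply pow_incr; lra. }
      assert (Hx : (0 <= Cmod x <= Cmod Q)%R).
      { unfold x. rewrite Cmod_pow; simpl. nra. }
      (* The tail after the constant term 1 is O(|x|), with a constant independent of k. *)
      assert (H := csum_lim_tail_le (fun j => hyp_coef a b Q j * x ^ j) K (Cmod x)
        (hyp a b Q x) 1 ltac:(lra)).
      assert (E : csum 1 (fun j => hyp_coef a b Q j * x ^ j) = 1).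
      { simpl. unfold hyp_coef, qpoch; simpl. field. }
      rewrite E in H.
      eapply Rle_trans; [apply H|].
      * intros j. rewrite Cmod_mult, Cmod_pow.
        apply Rmult_le_compat_r; auto. apply pow_le; lra.
      * apply hyp_cv; auto; lra.
      * rewrite pow_1. replace (K * Cmod Q / (1 - Cmod Q) * Cmod Q ^ k)%R
          with (K * Cmod x / (1 - Cmod Q))%R
          by (unfold x; rewrite Cmod_pow; simpl; field; lra).
        apply Rmult_le_compat_l; [apply Rmult_le_pos; lra|].
        apply Rinv_le_contravar; lra.
    + apply is_lim_seq_geom_scal; lra.
Qed.

(** * Expansion of the hypergeometric series in g_3 *)

Lemma hyp_telescope (a b Q : C) (N : nat) :
  (Cmod Q < 1)%R ->
  csum (S N) (fun n => hyp_coef a b Q n * Q ^ n)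
  - a * b * Q * csum (S N) (fun n => hyp_coef (a * Q) (b * Q) Q n * Q ^ n) =
  hyp_coef (a * Q) (b * Q) Q N * (1 - a * b * Q ^ S N).
Proof.
  (* The right-hand side T_N satisfies T_N - T_(N-1) = the N-th summand of the left-hand side, and
     T_0 is its summand at 0. *)
  intros HQ. induction N as [|N IH].
  { simpl. unfold hyp_coef, qpoch; simpl. field. }
  set (s1 := csum (S N) (fun n => hyp_coef a b Q n * Q ^ n)) in *.
  set (s2 := csum (S N) (fun n => hyp_coef (a * Q) (b * Q) Q n * Q ^ n)) in *.
  change (csum (S (S N)) (fun n => hyp_coef a b Q n * Q ^ n))
    with (s1 + hyp_coef a b Q (S N) * Q ^ S N).
  change (csum (S (S N)) (fun n => hyp_coef (a * Q) (b * Q) Q n * Q ^ n))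
    with (s2 + hyp_coef (a * Q) (b * Q) Q (S N) * Q ^ S N).
  transitivity ((s1 - a * b * Q * s2) + (hyp_coef a b Q (S N)
    - a * b * Q * hyp_coef (a * Q) (b * Q) Q (S N)) * Q ^ S N); [ring|].
  rewrite IH. unfold hyp_coef.
  assert (N1 := qpoch_neq_0 Q Q (S N) HQ HQ).
  rewrite (qpoch_head a), (qpoch_head b), (qpoch_S (a * Q)), (qpoch_S (b * Q)).
  rewrite qpoch_S in *.
  assert (N2 : qpoch Q Q N <> 0) by (apply qpoch_neq_0; auto).
  assert (N3 : 1 - Q * Q ^ N <> 0) by (intros E; apply N1; rewrite E; ring).
  simpl. field; auto.
Qed.

Lemma hyp_shift (a b Q P A B : C) :
  (Cmod Q < 1)%R -> (Cmod a <= 1)%R -> (Cmod b <= 1)%R ->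
  clim (fun n => qpoch Q Q n) P -> P <> 0 ->
  clim (fun n => qpoch (a * Q) Q n) A -> clim (fun n => qpoch (b * Q) Q n) B ->
  P * hyp a b Q Q = A * B + a * b * Q * (P * hyp (a * Q) (b * Q) Q Q).
Proof.
  intros HQ Ha Hb HP HP0 HA HB. assert (HQ0 := Cmod_ge_0 Q).
  assert (HaQ : (Cmod (a * Q) <= 1)%R)
    by (rewrite Cmod_mult; assert (H := Cmod_ge_0 a); nra).
  assert (HbQ : (Cmod (b * Q) <= 1)%R)
    by (rewrite Cmod_mult; assert (H := Cmod_ge_0 b); nra).
  destruct (qpoch_ge Q Q HQ HQ) as [m [Hm Hge]].
  assert (L1 : clim (fun N => csum (S N) (fun n => hyp_coef a b Q n * Q ^ n)
    - a * b * Q * csum (S N) (fun n => hyp_coef (a * Q) (b * Q) Q n * Q ^ n))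
    (hyp a b Q Q - a * b * Q * hyp (a * Q) (b * Q) Q Q)).
  { assert (HS : forall N, exists N', forall n, (N' <= n)%nat -> (N <= S n)%nat)
      by (intros N; exists N; lia).
    apply clim_minus; [|apply clim_scal].
    - apply (clim_subseq _ _ S HS (hyp_cv a b Q Q HQ Ha Hb HQ)).
    - apply (clim_subseq _ _ S HS (hyp_cv (a * Q) (b * Q) Q Q HQ HaQ HbQ HQ)). }
  assert (LQ : clim (fun N => Q ^ S N) 0).
  { apply clim_le with (e := fun n => (Cmod Q * Cmod Q ^ n)%R).
    - intros n. replace (Q ^ S n - 0) with (Q ^ S n) by ring. rewrite Cmod_pow; simpl; lra.
    - apply is_lim_seq_geom_scal; lra. }
  assert (L2 : clim (fun N => csum (S N) (fun n => hyp_coef a b Q n * Q ^ n)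
    - a * b * Q * csum (S N) (fun n => hyp_coef (a * Q) (b * Q) Q n * Q ^ n))
    (A * B * / P * (1 - a * b * 0))).
  { eapply clim_ext; [intros N; symmetry; apply (hyp_telescope a b Q N HQ)|].
    apply clim_mult.
    - apply clim_mult; [now apply clim_mult | now apply clim_inv with m].
    - apply clim_minus; [apply clim_const | now apply clim_scal]. }
  assert (E := clim_unique _ _ _ L1 L2).
  transitivity (P * (hyp a b Q Q - a * b * Q * hyp (a * Q) (b * Q) Q Q)
    + a * b * Q * (P * hyp (a * Q) (b * Q) Q Q)); [ring|].
  rewrite E. field; auto.
Qed.

(** Step j multiplies by (a Q^j)(b Q^j) Q = Q^(2j+2), which accumulates to Q^(K(K+1)). The infinite
    products at step j are A and B divided by (a;Q)_(j+1) and (b;Q)_(j+1); since b = Q/a, this is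
    the g_3 summand at x = a. *)
Lemma hyp_iterate (a b Q P A B : C) (K : nat) :
  a * b = Q -> Q <> 0 -> (Cmod Q < 1)%R -> (Cmod a < 1)%R -> (Cmod b < 1)%R ->
  clim (fun n => qpoch Q Q n) P -> P <> 0 ->
  clim (fun n => qpoch a Q n) A -> clim (fun n => qpoch b Q n) B ->
  P * hyp a b Q Q = A * B * csum K (g3_term a Q)
    + Q ^ (K * (K + 1)) * (P * hyp (a * Q ^ K) (b * Q ^ K) Q Q).
Proof.
  intros Hab HQ0 HQ Ha Hb HP HP0 HA HB.
  assert (Ha0 : a <> 0) by (intros E; apply HQ0; rewrite <- Hab, E; ring).
  assert (Hs : forall c k, (Cmod c < 1)%R -> (Cmod (c * Q ^ k) <= 1)%R).
  { intros c k Hc. rewrite Cmod_mult, Cmod_pow. assert (H := Cmod_ge_0 c). assert (H' := Cmod_ge_0 Q).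
    assert (0 <= Cmod Q ^ k <= 1)%R.
    { split; [apply pow_le; lra|]. rewrite <- (pow1 k); apply pow_incr; lra. }
    nra. }
  assert (Htail : forall c L k, (Cmod c < 1)%R -> clim (fun n => qpoch c Q n) L ->
    clim (fun n => qpoch (c * Q ^ k * Q) Q n) (L / qpoch c Q (S k))).
  { intros c L k Hc HL. assert (N := qpoch_neq_0 c Q (S k) Hc HQ).
    apply clim_ext with (fun n => / qpoch c Q (S k) * qpoch c Q (S k + n)).
    - intros n. rewrite qpoch_add. replace (c * Q ^ k * Q) with (c * Q ^ S k) by (simpl; ring).
      field; auto.
    - unfold Cdiv. rewrite (Cmult_comm L). apply clim_scal.
      apply (clim_subseq (fun n => qpoch c Q n) L (fun n => S k + n)%nat); auto.
      intros M; exists M; lia. }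
  induction K as [|K IH].
  - replace (a * Q ^ 0) with a by (simpl; ring). replace (b * Q ^ 0) with b by (simpl; ring).
    simpl; ring.
  - rewrite IH.
    rewrite (hyp_shift _ _ Q P _ _ HQ (Hs a K Ha) (Hs b K Hb) HP HP0
               (Htail a A K Ha HA) (Htail b B K Hb HB)).
    replace (a * Q ^ S K) with (a * Q ^ K * Q) by (simpl; ring).
    replace (b * Q ^ S K) with (b * Q ^ K * Q) by (simpl; ring).
    simpl csum. change (g3_term a Q K) with (pow_n Q (K * (K + 1)) / (qpoch a Q (S K) * qpoch (/ a * Q) Q (S K))).
    rewrite (pow_n_Cpow Q (K * (K + 1))).
    replace (/ a * Q) with b by (rewrite <- Hab; field; auto).
    replace (S K * (S K + 1))%nat with (K * (K + 1) + (K + K + 2))%nat by ring.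
    rewrite (Cpow_add_r Q (K * (K + 1))), !Cpow_add_r.
    set (h := hyp _ _ _ _).
    replace (a * Q ^ K * (b * Q ^ K)) with (Q * Q ^ K * Q ^ K) by (rewrite <- Hab at 1; ring).
    assert (N1 := qpoch_neq_0 a Q (S K) Ha HQ).
    assert (N2 := qpoch_neq_0 b Q (S K) Hb HQ).
    simpl (Q ^ 2). field; auto.
Qed.

Lemma g3_eq (a b Q P A B : C) :
  a * b = Q -> Q <> 0 -> (Cmod a < 1)%R -> (Cmod b < 1)%R ->
  clim (fun n => qpoch Q Q n) P -> P <> 0 ->
  clim (fun n => qpoch a Q n) A -> clim (fun n => qpoch b Q n) B ->
  A <> 0 -> B <> 0 ->
  is_g3 a Q (qsol a b Q P 0 / (A * B)).
Proof.
  intros Hab HQ0 Ha Hb HP HP0 HA HB HA0 HB0.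
  assert (HQ : (Cmod Q < 1)%R).
  { rewrite <- Hab, Cmod_mult. assert (H := Cmod_ge_0 a). assert (H' := Cmod_ge_0 b). nra. }
  assert (HQ1 := Cmod_ge_0 Q).
  destruct (hyp_coef_bounded Q HQ) as [M [HM HMb]].
  apply is_series_clim.
  assert (E : qsol a b Q P 0 = P * hyp a b Q Q).
  { unfold qsol. replace (Q ^ 1) with Q by (simpl; ring).
    change (qpoch Q Q 0) with (RtoC 1). field. }
  rewrite E.
  set (R0 := fun K => Q ^ (K * (K + 1)) * (P * hyp (a * Q ^ K) (b * Q ^ K) Q Q)).
  (* The remainder is Q^(K(K+1)) times a quantity bounded uniformly in K, by the uniform coefficient
     bound. *)
  assert (HR : clim R0 0).
  { apply clim_le with (e := fun K => (Cmod P * (M / (1 - Cmod Q)) * Cmod Q ^ K)%R);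
      [|apply is_lim_seq_geom_scal; lra].
    intros K. replace (R0 K - 0) with (R0 K) by ring. unfold R0.
    assert (Hq : forall n, (0 <= Cmod Q ^ n <= 1)%R).
    { intros n. split; [apply pow_le; lra|]. rewrite <- (pow1 n); apply pow_incr; lra. }
    assert (Hs : forall c, (Cmod c < 1)%R -> (Cmod (c * Q ^ K) <= 1)%R).
    { intros c Hc. rewrite Cmod_mult, Cmod_pow. assert (H := Cmod_ge_0 c).
      specialize (Hq K). nra. }
    rewrite !Cmod_mult, Cmod_pow, (Rmult_comm (Cmod Q ^ _)).
    apply Rmult_le_compat; [|apply Hq| |].
    - apply Rmult_le_pos; apply Cmod_ge_0.
    - apply Rmult_le_compat_l; [apply Cmod_ge_0|].
      set (f := fun j => hyp_coef (a * Q ^ K) (b * Q ^ K) Q j * Q ^ j).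
      (* A tail estimate from index 0 is a bound on the whole series. *)
      assert (T := csum_lim_tail_le f M (Cmod Q) (hyp (a * Q ^ K) (b * Q ^ K) Q Q) 0 ltac:(lra)).
      simpl in T. rewrite Rmult_1_r in T.
      replace (hyp (a * Q ^ K) (b * Q ^ K) Q Q)
        with (hyp (a * Q ^ K) (b * Q ^ K) Q Q - 0) by ring.
      apply T.
      + intros j. unfold f. rewrite Cmod_mult, Cmod_pow.
        apply Rmult_le_compat_r; [apply Hq|]. apply HMb; auto.
      + apply hyp_cv; auto.
    - replace (K * (K + 1))%nat with (K + K * K)%nat by ring. rewrite pow_add.
      assert (H1 := Hq K). assert (H2 := Hq (K * K)%nat). nra. }
  apply clim_ext with (fun K => / (A * B) * (P * hyp a b Q Q - R0 K)).
  - intros K. rewrite (hyp_iterate a b Q P A B K) by auto. unfold R0. field; auto.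
  - replace (P * hyp a b Q Q / (A * B)) with (/ (A * B) * (P * hyp a b Q Q - 0))
      by (field; auto).
    apply clim_scal, clim_minus; auto using clim_const.
Qed.

(** * Partitions *)

(** The sum of F over [subseqs L], following its recursion without building the list. A chosen entry
    is absorbed into the summand, so inductions have to generalise F. *)
Fixpoint wsum (F : list nat -> C) (L : list nat) : C :=
  match L with
  | [] => F []
  | x :: t => wsum (fun l => F (x :: l)) t + wsum F t
  end.

Lemma wsum_ext (F G : list nat -> C) (L : list nat) :
  (forall l, incl l L -> F l = G l) -> wsum F L = wsum G L.
Proof.
  revert F G; induction L as [|x t IH]; intros F G H; simpl.
  - apply H, incl_refl.
  - f_equal; apply IH; intros l Hl; apply H.
    + intros y [<-|Hy]; [left; auto | right; auto].
    + now apply incl_tl.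
Qed.

Lemma wsum_0 (L : list nat) : wsum (fun _ => 0) L = 0.
Proof. induction L as [|x t IH]; simpl; [|rewrite IH]; ring. Qed.

Lemma wsum_plus (F G : list nat -> C) (L : list nat) :
  wsum (fun l => F l + G l) L = wsum F L + wsum G L.
Proof.
  revert F G; induction L as [|x t IH]; intros F G; simpl; auto.
  rewrite (IH (fun l => F (x :: l)) (fun l => G (x :: l))), IH. ring.
Qed.

Lemma wsum_scal (c : C) (F : list nat -> C) (L : list nat) :
  wsum (fun l => c * F l) L = c * wsum F L.
Proof.
  revert F; induction L as [|x t IH]; intros F; simpl; auto.
  rewrite (IH (fun l => F (x :: l))), IH. ring.
Qed.

(** The recursion of [wsum] exposes the largest part; the functional equation removes the smallest
    one, at the other end. *)
Lemma wsum_snoc (F : list nat -> C) (L : list nat) (a : nat) :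
  wsum F (L ++ [a]) = wsum (fun l => F (l ++ [a])) L + wsum F L.
Proof.
  revert F; induction L as [|x t IH]; intros F; simpl; auto.
  rewrite (IH (fun l => F (x :: l))), IH. simpl. ring.
Qed.

Lemma wsum_count (p : list nat -> bool) (L : list nat) :
  RtoC (INR (length (filter p (subseqs L)))) = wsum (fun l => if p l then 1 else 0) L.
Proof.
  revert p; induction L as [|x t IH]; intros p; simpl; [now destruct (p [])|].
  rewrite filter_app, length_app, plus_INR, RtoC_plus.
  assert (H := IH (fun l => p (x :: l))). cbv beta in H. rewrite <- H, <- IH.
  replace (length (filter p (map (cons x) (subseqs t))))
    with (length (filter (fun l => p (x :: l)) (subseqs t))); auto.
  clear.   induction (subseqs t) as [|l ls IHl]; simpl; auto.
  destruct (p (x :: l)); simpl; rewrite IHl; auto.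
Qed.

Lemma rev_seq_S (n : nat) : rev (seq 1 (S n)) = S n :: rev (seq 1 n).
Proof. rewrite seq_S, rev_app_distr. reflexivity. Qed.

(** Lets [Ccount d r n], which draws its parts from [1, n], be summed over one range common to all
    n. *)
Lemma wsum_rev_seq_stable (F : list nat -> C) (n N : nat) :
  (n <= N)%nat -> (forall x l, (n < x)%nat -> F (x :: l) = 0) ->
  wsum F (rev (seq 1 N)) = wsum F (rev (seq 1 n)).
Proof.
  intros H HF. induction H as [|N H IH]; auto.
  rewrite rev_seq_S. simpl. rewrite IH.
  rewrite (wsum_ext _ (fun _ => 0)) by (intros; apply HF; lia).
  rewrite wsum_0. ring.
Qed.

(** Over sets of distinct parts, the sum of rho^size is the product of the 1 + rho^j, at most exp of
    a geometric series; the bound is uniform in N. *)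
Lemma wsum_rev_seq_le (F : list nat -> C) (K rho : R) (N : nat) :
  (0 <= rho < 1)%R -> (forall l, Cmod (F l) <= K * rho ^ sumlist l)%R ->
  (Cmod (wsum F (rev (seq 1 N))) <= K * exp (/ (1 - rho)))%R.
Proof.
  intros Hr HF.
  assert (HK : (0 <= K)%R)
    by (specialize (HF []); simpl in HF; assert (H := Cmod_ge_0 (F [])); lra).
  assert (H : (Cmod (wsum F (rev (seq 1 N))) <= K * exp ((1 - rho ^ N) / (1 - rho)))%R).
  { revert F K HF HK. induction N as [|N IH]; intros F K HF HK.
    - simpl. eapply Rle_trans; [apply HF|]. simpl.
      rewrite Rminus_diag. unfold Rdiv. rewrite Rmult_0_l, exp_0. lra.
    - rewrite rev_seq_S. simpl wsum. eapply Rle_trans; [apply Cmod_triangle|].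
      assert (Hp : (0 <= rho ^ S N)%R) by (apply pow_le; lra).
      assert (Hp' : (0 <= rho ^ N)%R) by (apply pow_le; lra).
      eapply Rle_trans; [apply Rplus_le_compat|].
      + apply IH with (K := (K * rho ^ S N)%R); [|now apply Rmult_le_pos].
        intros l. eapply Rle_trans; [apply HF|].
        change (sumlist (S N :: l)) with (S N + sumlist l)%nat. rewrite pow_add. lra.
      + apply IH with (1 := HF); auto.
      + replace ((1 - rho ^ S N) / (1 - rho))%R
          with ((1 - rho ^ N) / (1 - rho) + rho ^ N)%R by (simpl; field; lra).
        rewrite exp_plus. assert (HE := exp_pos ((1 - rho ^ N) / (1 - rho))).
        set (E := exp ((1 - rho ^ N) / (1 - rho))) in *.
        assert (rho ^ S N + 1 <= exp (rho ^ N))%R.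
        { eapply Rle_trans; [|apply exp_ineq1_le]. simpl. nra. }
        replace (K * rho ^ S N * E + K * E)%R with (K * E * (rho ^ S N + 1))%R by ring.
        rewrite <- Rmult_assoc. apply Rmult_le_compat_l; auto.
        apply Rmult_le_pos; lra. }
  eapply Rle_trans; [apply H|]. apply Rmult_le_compat_l; auto.
  assert (0 <= rho ^ N)%R by (apply pow_le; lra).
  assert (0 < / (1 - rho))%R by (apply Rinv_0_lt_compat; lra).
  assert (L : ((1 - rho ^ N) / (1 - rho) <= / (1 - rho))%R) by (unfold Rdiv; nra).
  destruct L as [L|E]; [now apply Rlt_le, exp_increasing | rewrite E; lra].
Qed.

(* The decreasing lists that are summed over have their parts in [a < part <= N]. *)
Definition usum (F : list nat -> C) (N a : nat) : C :=
  wsum F (rev (seq (S a) (N - a))).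

Lemma usum_ge (F : list nat -> C) (N a : nat) : (N <= a)%nat -> usum F N a = F [].
Proof. intros H. unfold usum. now replace (N - a)%nat with O by lia. Qed.

Lemma usum_step (F : list nat -> C) (N a : nat) :
  (a < N)%nat ->
  usum F N a = usum (fun l => F (l ++ [S a])) N (S a) + usum F N (S a).
Proof.
  intros H. unfold usum. replace (N - a)%nat with (S (N - S a)) by lia.
  simpl. apply wsum_snoc.
Qed.

Lemma usum_ext (F G : list nat -> C) (N a : nat) :
  (forall l, (forall x, In x l -> (a < x)%nat) -> F l = G l) -> usum F N a = usum G N a.
Proof.
  intros H. apply wsum_ext. intros l Hl. apply H. intros x Hx.
  apply Hl, in_rev, in_seq in Hx. lia.
Qed.

(** Raises the threshold past values that cannot be the smallest part of a list of nonzero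
    weight. *)
Lemma usum_drop (F : list nat -> C) (N a b : nat) :
  (a <= b)%nat ->
  (forall c l, (a < c <= b)%nat -> F (l ++ [c]) = 0) -> usum F N a = usum F N b.
Proof.
  intros H HF. induction H as [|b H IH]; auto.
  rewrite IH by (intros; apply HF; lia).
  destruct (le_lt_dec N b) as [L|L]; [rewrite !usum_ge by lia; auto|].
  rewrite usum_step by auto.
  rewrite (usum_ext _ (fun _ => 0)) by (intros; apply HF; lia).
  unfold usum at 1. rewrite wsum_0. ring.
Qed.

(** * The recurrence from removing the smallest part *)

Lemma gaps_ok_snoc2 (d : nat) (l : list nat) (b a : nat) :
  gaps_ok d ((l ++ [b]) ++ [a]) = (gaps_ok d (l ++ [b]) && gap_ok d b a)%bool.
Proof.
  induction l as [|x t IH]; simpl; [now rewrite Bool.andb_true_r|].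
  destruct t as [|y t]; simpl in *.
  - rewrite !Bool.andb_true_r. reflexivity.
  - rewrite IH, Bool.andb_assoc. reflexivity.
Qed.

(** The condition on the smallest part is left out: the threshold of [usum] carries it. *)
Definition wt (d r : nat) (q : C) (l : list nat) : C :=
  if (forallb (part_residue_ok d r) l && gaps_ok d l)%bool then q ^ sumlist l else 0.

Lemma sumlist_app (l m : list nat) : sumlist (l ++ m) = (sumlist l + sumlist m)%nat.
Proof. induction l as [|x t IH]; simpl in *; [|rewrite IH]; lia. Qed.

Lemma wt_bad_residue (d r : nat) (q : C) (l : list nat) (c : nat) :
  part_residue_ok d r c = false -> wt d r q (l ++ [c]) = 0.
Proof.
  intros H. unfold wt. rewrite forallb_app. simpl. rewrite H.
  now rewrite Bool.andb_false_r.
Qed.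

(** If c is the smallest part, the gap condition only restricts the next part, to values above e; so
    removing c leaves the same sum with threshold e. *)
Lemma wt_smallest (d r : nat) (q : C) (N c e : nat) :
  part_residue_ok d r c = true -> (c <= e)%nat ->
  (forall b, (c < b)%nat -> gap_ok d b c = (e <? b)%nat) ->
  usum (fun l => wt d r q (l ++ [c])) N c = q ^ c * usum (wt d r q) N e.
Proof.
  intros Hc He Hgap.
  rewrite (usum_drop _ N c e He).
  - unfold usum. rewrite <- wsum_scal. apply (usum_ext _ (fun l => q ^ c * wt d r q l)).
    intros l Hl. unfold wt. rewrite forallb_app. simpl. rewrite Hc, !Bool.andb_true_r.
    assert (G : gaps_ok d (l ++ [c]) = gaps_ok d l).
    { destruct l as [|b l _] using rev_ind; [reflexivity|].
      assert (e < b)%nat by (apply Hl, in_or_app; right; left; auto).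
      rewrite gaps_ok_snoc2, Hgap by lia.
      replace (e <? b)%nat with true by (symmetry; apply Nat.ltb_lt; auto).
      apply Bool.andb_true_r. }
    rewrite G. destruct (forallb _ _ && gaps_ok d l)%bool; [|ring].
    rewrite sumlist_app. simpl. rewrite Nat.add_0_r, Cpow_add_r. ring.
  - intros b l Hb. unfold wt. rewrite gaps_ok_snoc2, Hgap by lia.
    replace (e <? b)%nat with false by (symmetry; apply Nat.ltb_ge; lia).
    now rewrite !Bool.andb_false_r.
Qed.

Lemma mod_mul_add (d k s : nat) : (s < d)%nat -> ((k * d + s) mod d = s)%nat.
Proof. intros H. symmetry. apply Nat.mod_unique with k; lia. Qed.

Lemma part_residue_ok_iff (d r k s : nat) :
  (s < d)%nat ->
  part_residue_ok d r (k * d + s) = (Nat.eqb s 0 || Nat.eqb s r || Nat.eqb s (d - r))%bool.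
Proof. intros H. unfold part_residue_ok. now rewrite mod_mul_add. Qed.

(** Strictness depends on the larger part b, but matters only for b = c + d, which has the residue
    of c. The required gap is therefore decided by c, the part being removed. *)
Lemma gap_ok_nondiv (d c b : nat) :
  (0 < d)%nat -> (c mod d <> 0)%nat -> gap_ok d b c = (c + d - 1 <? b)%nat.
Proof.
  intros Hd Hc. unfold gap_ok.
  destruct (Nat.leb_spec (c + d) b) as [H|H]; simpl.
  - transitivity true; [|symmetry; apply Nat.ltb_lt; lia].
    destruct (Nat.ltb_spec (c + d) b) as [H1|H1]; [apply Bool.orb_true_r|].
    replace b with (c + 1 * d)%nat by lia. rewrite Nat.Div0.mod_add.
    apply Nat.eqb_neq in Hc. now rewrite Hc.
  - symmetry. apply Nat.ltb_ge. lia.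
Qed.

Lemma gap_ok_div (d c b : nat) :
  (c mod d = 0)%nat -> gap_ok d b c = (c + d <? b)%nat.
Proof.
  intros Hc. unfold gap_ok.
  destruct (Nat.ltb_spec (c + d) b) as [H|H].
  - rewrite Bool.orb_true_r, Bool.andb_true_r. apply Nat.leb_le. lia.
  - rewrite Bool.orb_false_r. destruct (Nat.leb_spec (c + d) b) as [H1|H1]; auto.
    replace b with (c + 1 * d)%nat by lia. now rewrite Nat.Div0.mod_add, Hc.
Qed.

Lemma usum_wt_skip (d r : nat) (q : C) (N k s t : nat) :
  (s <= t)%nat -> (t < d)%nat ->
  (forall u, (s < u <= t)%nat -> u <> r /\ u <> (d - r)%nat) ->
  usum (wt d r q) N (k * d + s) = usum (wt d r q) N (k * d + t).
Proof.
  intros Hst Ht Hu. apply usum_drop; [lia|].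
  intros c l Hc. apply wt_bad_residue.
  replace c with (k * d + (c - k * d))%nat by lia.
  rewrite part_residue_ok_iff by lia.
  destruct (Hu (c - k * d)%nat ltac:(lia)) as [H1 H2].
  apply Nat.eqb_neq in H1, H2. rewrite H1, H2.
  replace (Nat.eqb (c - k * d) 0) with false by (symmetry; apply Nat.eqb_neq; lia).
  reflexivity.
Qed.

(** Either kd + s is not a part, or it is the smallest one and the next part is at least (k + 1)d +
    s: the same threshold one block higher. *)
Lemma usum_wt_take (d r : nat) (q : C) (N k s : nat) :
  (0 < s < d)%nat -> s = r \/ s = (d - r)%nat -> (k * d + s <= N)%nat ->
  usum (wt d r q) N (k * d + (s - 1)) =
  usum (wt d r q) N (k * d + s) + q ^ (k * d + s) * usum (wt d r q) N (S k * d + (s - 1)).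
Proof.
  intros Hs Hr HN.
  rewrite usum_step by lia. replace (S (k * d + (s - 1))) with (k * d + s)%nat by lia.
  rewrite (wt_smallest d r q N (k * d + s) (S k * d + (s - 1))).
  - ring.
  - rewrite part_residue_ok_iff by lia. destruct Hr as [<-|<-]; rewrite Nat.eqb_refl;
      rewrite ?Bool.orb_true_r; reflexivity.
  - lia.
  - intros b Hb. rewrite gap_ok_nondiv; [f_equal; simpl; lia | lia |].
    rewrite mod_mul_add; lia.
Qed.

Lemma usum_wt_take_div (d r : nat) (q : C) (N k : nat) :
  (0 < d)%nat -> (S k * d <= N)%nat ->
  usum (wt d r q) N (k * d + (d - 1)) =
  usum (wt d r q) N (S k * d) + q ^ (S k * d) * usum (wt d r q) N (S (S k) * d).
Proof.
  intros Hd HN. simpl in HN.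
  rewrite usum_step by lia. replace (S (k * d + (d - 1))) with (S k * d)%nat by (simpl; lia).
  assert (M : ((S k * d) mod d = 0)%nat) by apply Nat.Div0.mod_mul.
  rewrite (wt_smallest d r q N (S k * d) (S (S k) * d)).
  - ring.
  - unfold part_residue_ok. rewrite M. reflexivity.
  - simpl; lia.
  - intros b Hb. rewrite gap_ok_div by auto. f_equal. simpl; lia.
Qed.

(** The truncation of f(Q^k): parts in (kd, Md]. *)
Definition part_gf (d r : nat) (q : C) (M k : nat) : C := usum (wt d r q) (M * d) (k * d).

Lemma part_gf_ge (d r : nat) (q : C) (M k : nat) : (M <= k)%nat -> part_gf d r q M k = 1.
Proof.
  intros H. unfold part_gf. rewrite usum_ge by (apply Nat.mul_le_mono_r; auto). reflexivity.
Qed.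

Lemma part_gf_take_r (d r : nat) (q : C) (M k : nat) :
  (1 <= r)%nat -> (2 * r < d)%nat -> (k < M)%nat ->
  part_gf d r q M k = usum (wt d r q) (M * d) (k * d + r) + q ^ (k * d + r) * part_gf d r q M (S k).
Proof.
  intros Hr1 Hr2 HM. assert (S k * d <= M * d)%nat by (apply Nat.mul_le_mono_r; lia).
  unfold part_gf. simpl in H.
  rewrite <- (Nat.add_0_r (k * d)) at 1. rewrite (usum_wt_skip d r q _ k 0 (r - 1)) by lia.
  rewrite usum_wt_take by lia.
  rewrite <- (usum_wt_skip d r q _ (S k) 0 (r - 1)) by lia.
  now rewrite (Nat.add_0_r (S k * d)).
Qed.

(** Crosses the residues d - r and 0 of block k. The part kd + (d - r) leads back to a sum starting
    just after residue r, so the system closes in two unknown sequences. *)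
Lemma part_gf_take_dr (d r : nat) (q : C) (M k : nat) :
  (1 <= r)%nat -> (2 * r < d)%nat -> (k < M)%nat ->
  usum (wt d r q) (M * d) (k * d + r) =
  q ^ (k * d + (d - r)) * usum (wt d r q) (M * d) (S k * d + r)
  + part_gf d r q M (S k) + q ^ (S k * d) * part_gf d r q M (S (S k)).
Proof.
  intros Hr1 Hr2 HM. assert (S k * d <= M * d)%nat by (apply Nat.mul_le_mono_r; lia).
  unfold part_gf. simpl in H.
  rewrite (usum_wt_skip d r q _ k r (d - r - 1)) by lia.
  rewrite usum_wt_take by lia.
  rewrite <- (usum_wt_skip d r q _ (S k) r (d - r - 1)) by lia.
  rewrite (usum_wt_skip d r q _ k (d - r) (d - 1)) by lia.
  rewrite usum_wt_take_div by (simpl; lia). ring.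
Qed.

(** Eliminates the auxiliary sequence with threshold kd + r. Its correction carries q^(kd + d - r)
    q^((k+1)d + r) = Q^(2(k+1)), whence the factor 1 - Q^(k+1). *)
Lemma part_gf_rec (d r : nat) (q : C) (M k : nat) :
  (1 <= r)%nat -> (2 * r < d)%nat -> (S k < M)%nat ->
  part_gf d r q M k =
  (1 - (q ^ d) ^ k * (- q ^ r + - q ^ (d - r))) * part_gf d r q M (S k)
  + (q ^ d) ^ S k * (1 - (q ^ d) ^ S k) * part_gf d r q M (S (S k)).
Proof.
  intros Hr1 Hr2 HM.
  rewrite part_gf_take_r, part_gf_take_dr by lia.
  assert (E := part_gf_take_r d r q M (S k) Hr1 Hr2 HM).
  set (h := usum _ _ (S k * d + r)) in *.
  replace h with (part_gf d r q M (S k) - q ^ (S k * d + r) * part_gf d r q M (S (S k)))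
    by (rewrite E; ring).
  rewrite <- !Cpow_mult_r.
  assert (E1 : q ^ (k * d + (d - r)) * q ^ (S k * d + r) = q ^ (d * S k) * q ^ (d * S k)).
  { rewrite <- !Cpow_add_r. f_equal. simpl. lia. }
  replace (S k * d)%nat with (d * S k)%nat in * by ring.
  replace (k * d)%nat with (d * k)%nat in * by ring.
  rewrite !(Cpow_add_r q (d * k)).
  transitivity ((q ^ (d * k) * q ^ (d - r) + 1 + q ^ (d * k) * q ^ r) * part_gf d r q M (S k)
    + (q ^ (d * S k) - q ^ (d * k + (d - r)) * q ^ (d * S k + r)) * part_gf d r q M (S (S k))).
  { rewrite (Cpow_add_r q (d * k) (d - r)). ring. }
  rewrite E1. ring.
Qed.

(** One block of length d leaves room for at most one part. This is the second boundary value, next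
    to [part_gf_ge]. *)
Lemma part_gf_pred (d r : nat) (q : C) (M : nat) :
  (1 <= r)%nat -> (2 * r < d)%nat ->
  part_gf d r q (S M) M = 1 + (q ^ d) ^ M * (q ^ r + q ^ (d - r) + q ^ d).
Proof.
  intros Hr1 Hr2. rewrite part_gf_take_r, part_gf_take_dr by lia.
  rewrite !part_gf_ge, usum_ge by lia.
  change (wt d r q []) with (RtoC 1).
  replace (S M * d)%nat with (d * M + d)%nat by ring.
  replace (M * d)%nat with (d * M)%nat in * by ring.
  rewrite !Cpow_add_r, <- Cpow_mult_r. ring.
Qed.

(** * Comparison with the coefficients [Ccount] *)

Definition good_part (d r : nat) (l : list nat) : bool :=
  forallb (part_residue_ok d r) l && gaps_ok d l && last_gt d l.

Lemma last_gt_snoc (d : nat) (l : list nat) (c : nat) : last_gt d (l ++ [c]) = (d <? c)%nat.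
Proof.
  induction l as [|x t IH]; auto.
  simpl app. destruct t as [|y t]; auto.
Qed.

Lemma last_gt_all (d : nat) (l : list nat) :
  (forall x, In x l -> (d < x)%nat) -> last_gt d l = true.
Proof.
  intros H. destruct l as [|c l _] using rev_ind; auto.
  rewrite last_gt_snoc. apply Nat.ltb_lt, H, in_or_app. right; left; auto.
Qed.

Lemma part_gf_1 (d r : nat) (q : C) (M : nat) :
  part_gf d r q M 1 =
  wsum (fun l => if good_part d r l then q ^ sumlist l else 0) (rev (seq 1 (M * d))).
Proof.
  set (F := fun l => if good_part d r l then q ^ sumlist l else 0).
  transitivity (usum F (M * d) 0).
  - unfold part_gf. rewrite Nat.mul_1_l. rewrite (usum_drop F _ 0 d); [|lia|].
    + apply usum_ext. intros l Hl. unfold F, wt, good_part.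
      now rewrite (last_gt_all d l Hl), Bool.andb_true_r.
    + intros c l Hc. unfold F, good_part. rewrite last_gt_snoc.
      replace (d <? c)%nat with false by (symmetry; apply Nat.ltb_ge; lia).
      now rewrite Bool.andb_false_r.
  - unfold usum. now rewrite Nat.sub_0_r.
Qed.

Lemma Ccount_wsum (d r : nat) (q : C) (n N : nat) :
  (n <= N)%nat ->
  RtoC (INR (Ccount d r n)) * q ^ n =
  wsum (fun l => if (Nat.eqb (sumlist l) n && good_part d r l)%bool then q ^ sumlist l else 0)
    (rev (seq 1 N)).
Proof.
  intros H. unfold Ccount. rewrite wsum_count, Cmult_comm, <- wsum_scal.
  rewrite (wsum_rev_seq_stable _ n N H).
  - apply wsum_ext. intros l _. unfold valid_part, good_part. rewrite !Bool.andb_assoc.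
    destruct (Nat.eqb_spec (sumlist l) n) as [->|E]; simpl; [|ring].
    destruct (_ && last_gt d l)%bool; ring.
  - intros x l Hx. simpl sumlist.
    replace (Nat.eqb (x + sumlist l) n) with false by (symmetry; apply Nat.eqb_neq; lia).
    reflexivity.
Qed.

Lemma Ccount_partial_sum (d r : nat) (q : C) (m N : nat) :
  (m <= S N)%nat ->
  csum m (fun n => RtoC (INR (Ccount d r n)) * q ^ n) =
  wsum (fun l => if (Nat.ltb (sumlist l) m && good_part d r l)%bool then q ^ sumlist l else 0)
    (rev (seq 1 N)).
Proof.
  induction m as [|m IH]; intros H.
  - simpl csum. rewrite (wsum_ext _ (fun _ => 0)), wsum_0; auto.
  - simpl csum. rewrite IH, (Ccount_wsum d r q m N), <- wsum_plus by lia.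
    apply wsum_ext. intros l _.
    destruct (Nat.ltb_spec (sumlist l) m), (Nat.eqb_spec (sumlist l) m),
      (Nat.ltb_spec (sumlist l) (S m)); try lia; destruct (good_part d r l); simpl; ring.
Qed.

(** The difference runs over partitions of numbers s >= m, where |q|^s = rho^(2s) <= rho^m rho^s.
    The bound does not depend on M. *)
Lemma Ccount_partial_sum_dist (d r : nat) (q : C) (m M : nat) :
  (Cmod q < 1)%R -> (m <= S (M * d))%nat ->
  let rho := sqrt (Cmod q) in
  (Cmod (csum m (fun n => RtoC (INR (Ccount d r n)) * q ^ n) - part_gf d r q M 1)%C
   <= rho ^ m * exp (/ (1 - rho)))%R.
Proof.
  intros Hq Hm rho. assert (Hq0 := Cmod_ge_0 q).
  assert (Hr2 : (rho * rho = Cmod q)%R) by (apply sqrt_sqrt; auto).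
  assert (Hr0 : (0 <= rho)%R) by apply sqrt_pos.
  assert (Hr : (0 <= rho < 1)%R) by (split; nra).
  rewrite (Ccount_partial_sum d r q m (M * d) Hm), part_gf_1.
  set (F := fun l => if (Nat.leb m (sumlist l) && good_part d r l)%bool then - q ^ sumlist l else 0).
  replace (_ - _) with (wsum F (rev (seq 1 (M * d)))).
  - apply wsum_rev_seq_le; auto. intros l. unfold F.
    assert (P : (0 <= rho ^ m * rho ^ sumlist l)%R) by (apply Rmult_le_pos; apply pow_le; lra).
    destruct (Nat.leb_spec m (sumlist l)) as [H|H]; [|simpl; now rewrite Cmod_0].
    destruct (good_part d r l); simpl; [|now rewrite Cmod_0].
    rewrite Cmod_opp, Cmod_pow, <- Hr2, Rpow_mult_distr.
    apply Rmult_le_compat_r; [apply pow_le; lra|].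
    replace (sumlist l) with (m + (sumlist l - m))%nat by lia. rewrite pow_add.
    assert (0 <= rho ^ m)%R by (apply pow_le; lra).
    assert (rho ^ (sumlist l - m) <= 1)%R.
    { rewrite <- (pow1 (sumlist l - m)). apply pow_incr; lra. }
    nra.
  - unfold Cminus. rewrite <- (Cmult_1_l (- _)).
    replace (1 * - wsum (fun l => if good_part d r l then q ^ sumlist l else 0) (rev (seq 1 (M * d))))
      with ((- (1)) * wsum (fun l => if good_part d r l then q ^ sumlist l else 0) (rev (seq 1 (M * d)))) by ring.
    rewrite <- wsum_scal, <- wsum_plus. apply wsum_ext. intros l _. unfold F.
    destruct (Nat.leb_spec m (sumlist l)), (Nat.ltb_spec (sumlist l) m); try lia;
      destruct (good_part d r l); simpl; ring.
Qed.

(** * Stability of the recurrence and the limit of the truncations *)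

Lemma recurrence_stable (D al be : nat -> C) (c p e : R) (n : nat) :
  (0 <= c)%R -> (0 <= p < 1)%R -> (0 <= e)%R ->
  (forall k, (k < n)%nat -> D k = al k * D (S k) + be k * D (S (S k))) ->
  (forall k, Cmod (al k) + Cmod (be k) <= 1 + c * p ^ k)%R ->
  (Cmod (D n) <= e)%R -> (Cmod (D (S n)) <= e)%R ->
  (Cmod (D O) <= e * exp (c / (1 - p)))%R.
Proof.
  intros Hc Hp He HD Hab Hn HSn.
  (* X k is e times the product of exp (c p^j) over k <= j < n, a supersolution of the recurrence
     run downwards from n. *)
  set (X := fun k => (e * exp (c * (p ^ k - p ^ n) / (1 - p)))%R).
  assert (Hpow : forall k, (0 <= p ^ k)%R) by (intros; apply pow_le; lra).
  assert (HX0 : forall k, (0 <= X k)%R).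
  { intros k. apply Rmult_le_pos; auto. apply Rlt_le, exp_pos. }
  assert (HX : forall k, ((1 + c * p ^ k) * X (S k) <= X k)%R).
  { intros k. unfold X.
    replace (c * (p ^ k - p ^ n) / (1 - p))%R
      with (c * p ^ k + c * (p ^ S k - p ^ n) / (1 - p))%R by (simpl; field; lra).
    rewrite exp_plus. assert (H := exp_ineq1_le (c * p ^ k)).
    assert (H' := HX0 (S k)). unfold X in H'. nra. }
  (* The recurrence has order two, so D k and D (S k) are bounded together by X k. *)
  assert (H : forall j, (j <= n)%nat ->
    (Cmod (D (n - j)%nat) <= X (n - j)%nat /\ Cmod (D (S (n - j))) <= X (n - j)%nat)%R).
  { induction j as [|j IH]; intros Hj.
    - rewrite Nat.sub_0_r. unfold X. rewrite Rminus_diag. unfold Rdiv.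
      rewrite Rmult_0_r, Rmult_0_l, exp_0, Rmult_1_r. auto.
    - specialize (IH ltac:(lia)). replace (n - j)%nat with (S (n - S j)) in IH by lia.
      set (k := (n - S j)%nat) in *. destruct IH as [I1 I2].
      specialize (HX k). assert (P := Hpow k). assert (P' := HX0 (S k)).
      assert (0 <= c * p ^ k)%R by nra.
      split; [|nra].
      rewrite HD by (unfold k; lia).
      eapply Rle_trans; [apply Cmod_triangle|]. rewrite !Cmod_mult.
      assert (A := Cmod_ge_0 (al k)). assert (B := Cmod_ge_0 (be k)).
      specialize (Hab k). nra. }
  destruct (H n (le_n n)) as [H0 _]. rewrite Nat.sub_diag in H0.
  eapply Rle_trans; [apply H0|]. unfold X. apply Rmult_le_compat_l; auto. simpl.
  assert (Hi : (0 < / (1 - p))%R) by (apply Rinv_0_lt_compat; lra).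
  assert (L : (c * (1 - p ^ n) / (1 - p) <= c / (1 - p))%R).
  { unfold Rdiv. apply Rmult_le_compat_r; [lra|]. specialize (Hpow n). nra. }
  destruct L as [L|E]; [now apply Rlt_le, exp_increasing | rewrite E; lra].
Qed.

Lemma Cmod_pow_le_1 (z : C) (n : nat) : (Cmod z <= 1)%R -> (Cmod (z ^ n) <= 1)%R.
Proof.
  intros H. rewrite Cmod_pow, <- (pow1 n). apply pow_incr. split; [apply Cmod_ge_0 | auto].
Qed.

Lemma Cmod_pow_lt_1 (z : C) (n : nat) : (Cmod z < 1)%R -> (0 < n)%nat -> (Cmod (z ^ n) < 1)%R.
Proof.
  intros H Hn. destruct n as [|n]; [lia|]. rewrite Cpow_S, Cmod_mult.
  assert (H1 := Cmod_pow_le_1 z n (Rlt_le _ _ H)). assert (H0 := Cmod_ge_0 z).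
  assert (H2 := Cmod_ge_0 (z ^ n)). nra.
Qed.

Lemma part_gf_lim (d r : nat) (q P : C) :
  (1 <= r)%nat -> (2 * r < d)%nat -> (Cmod q < 1)%R ->
  clim (fun n => qpoch (q ^ d) (q ^ d) n) P -> P <> 0 ->
  clim (fun n => part_gf d r q (S (S n)) 1) (qsol (- q ^ r) (- q ^ (d - r)) (q ^ d) P 0).
Proof.
  intros Hr1 Hr2 Hq HP HP0.
  set (a := - q ^ r). set (b := - q ^ (d - r)). set (Q := q ^ d) in *.
  assert (HQ : (Cmod Q < 1)%R) by (apply Cmod_pow_lt_1; auto; lia).
  assert (Hz : (Cmod (q ^ r) < 1)%R) by (apply Cmod_pow_lt_1; auto; lia).
  assert (Hz' : (Cmod (q ^ (d - r)) < 1)%R) by (apply Cmod_pow_lt_1; auto; lia).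
  assert (Ha : (Cmod a <= 1)%R) by (unfold a; rewrite Cmod_opp; lra).
  assert (Hb : (Cmod b <= 1)%R) by (unfold b; rewrite Cmod_opp; lra).
  assert (Hab : a * b = Q).
  { unfold a, b, Q. replace d with (r + (d - r))%nat at 2 by lia. rewrite Cpow_add_r. ring. }
  assert (HQ0 := Cmod_ge_0 Q).
  assert (Hlim := qsol_lim a b Q P HQ Ha Hb HP HP0).
  set (f := qsol a b Q P) in *.
  (* Covers both boundary errors: f n and f (n + 1) are close to 1, and [part_gf_pred] differs from
     1 by at most 3|Q|^(n+1). *)
  set (e := fun n => (3 * Cmod Q ^ n + (Cmod (f n - 1) + Cmod (f (S n) - 1)))%R).
  assert (Hpow : forall n, (0 <= Cmod Q ^ n)%R) by (intros; apply pow_le; lra).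
  (* 4 = 2 + 2: |a + b| <= 2 in the first coefficient and |1 - Q^(k+2)| <= 2 in the second. *)
  apply clim_le with (e := fun n => (e n * exp (4 / (1 - Cmod Q)))%R).
  - intros n. set (M := S (S n)).
    apply recurrence_stable with (n := n)
      (D := fun k => part_gf d r q M (S k) - f k)
      (al := fun k => 1 - Q ^ S k * (a + b))
      (be := fun k => Q ^ S (S k) * (1 - Q ^ S (S k))); try lra.
    + unfold e. assert (H := Hpow n). assert (H1 := Cmod_ge_0 (f n - 1)).
      assert (H2 := Cmod_ge_0 (f (S n) - 1)). lra.
    + intros k Hk. rewrite part_gf_rec by (unfold M; lia).
      unfold f. rewrite (qsol_rec a b Q P k Hab HQ Ha Hb). unfold a, b, Q. ring.
    + intros k.
      assert (H1 : (Cmod (Q ^ S k) <= Cmod Q ^ k)%R)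
        by (rewrite Cmod_pow; simpl; specialize (Hpow k); nra).
      assert (H2 : (Cmod (Q ^ S (S k)) <= Cmod Q ^ k)%R).
      { rewrite Cpow_S, Cmod_mult. assert (H := Cmod_ge_0 (Q ^ S k)). nra. }
      assert (T1 := Cmod_triangle 1 (- (Q ^ S k * (a + b)))).
      rewrite Cmod_opp, Cmod_mult, Cmod_1 in T1.
      assert (T2 := Cmod_triangle a b).
      rewrite Cmod_mult.
      assert (T3 := Cmod_triangle 1 (- (Q ^ S (S k)))).
      rewrite Cmod_opp, Cmod_1 in T3.
      assert (T4 := Cmod_pow_le_1 Q (S (S k)) (Rlt_le _ _ HQ)).
      assert (G1 := Cmod_ge_0 (Q ^ S k)). assert (G2 := Cmod_ge_0 (Q ^ S (S k))).
      assert (G3 := Cmod_ge_0 (a + b)). unfold Cminus.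
      assert (U1 : (Cmod (Q ^ S k) * Cmod (a + b) <= Cmod Q ^ k * 2)%R)
        by (apply Rmult_le_compat; auto; lra).
      assert (U2 : (Cmod (Q ^ S (S k)) * Cmod (1 + - Q ^ S (S k)) <= Cmod Q ^ k * 2)%R)
        by (apply Rmult_le_compat; auto using Cmod_ge_0; lra).
      lra.
    + unfold M. rewrite part_gf_pred by auto. fold Q.
      replace (1 + Q ^ S n * (q ^ r + q ^ (d - r) + Q) - f n)
        with (Q * (q ^ r + q ^ (d - r) + Q) * Q ^ n + - (f n - 1)) by (simpl; ring).
      eapply Rle_trans; [apply Cmod_triangle|]. rewrite Cmod_opp, !Cmod_mult, Cmod_pow.
      assert (T1 := Cmod_triangle (q ^ r + q ^ (d - r)) Q).
      assert (T2 := Cmod_triangle (q ^ r) (q ^ (d - r))).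
      assert (G := Cmod_ge_0 (f (S n) - 1)). unfold e.
      assert (G3 := Cmod_ge_0 (q ^ r + q ^ (d - r) + Q)).
      assert (U : (Cmod Q * Cmod (q ^ r + q ^ (d - r) + Q) <= 3)%R) by nra.
      specialize (Hpow n). nra.
    + unfold M. rewrite part_gf_ge by auto.
      replace (1 - f (S n)) with (- (f (S n) - 1)) by ring. rewrite Cmod_opp.
      unfold e. assert (H := Hpow n). assert (H1 := Cmod_ge_0 (f n - 1)). lra.
  - replace (Finite 0) with (Finite ((0 + (0 + 0)) * exp (4 / (1 - Cmod Q)))) by (f_equal; ring).
    apply is_lim_seq_mult'; [|apply is_lim_seq_const].
    apply is_lim_seq_plus'; [apply is_lim_seq_geom_scal; lra|].
    apply is_lim_seq_plus'; [apply Hlim|].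
    apply (is_lim_seq_incr_1 (fun n => Cmod (f n - 1))), Hlim.
Qed.

Lemma Ccount_series (d r : nat) (q P : C) :
  (1 <= r)%nat -> (2 * r < d)%nat -> (Cmod q < 1)%R ->
  clim (fun n => qpoch (q ^ d) (q ^ d) n) P -> P <> 0 ->
  clim (fun m => csum m (fun n => RtoC (INR (Ccount d r n)) * q ^ n))
    (qsol (- q ^ r) (- q ^ (d - r)) (q ^ d) P 0).
Proof.
  intros Hr1 Hr2 Hq HP HP0.
  assert (L := part_gf_lim d r q P Hr1 Hr2 Hq HP HP0).
  set (l := qsol _ _ _ _ _) in *.
  set (s := fun m => csum m (fun n => RtoC (INR (Ccount d r n)) * q ^ n)).
  assert (Hq0 := Cmod_ge_0 q).
  assert (Hr : (0 <= sqrt (Cmod q) < 1)%R).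
  { split; [apply sqrt_pos|]. rewrite <- sqrt_1. apply sqrt_lt_1; lra. }
  (* Any bound on the parts that grows with m would do for the comparison; m + 2 blocks is the one
     for which [part_gf_lim] gives the limit. *)
  apply clim_ext with (fun m => (s m - part_gf d r q (S (S m)) 1) + part_gf d r q (S (S m)) 1);
    [intros; unfold s; ring|].
  replace l with (0 + l) by ring. apply clim_plus; auto.
  apply clim_le with (e := fun m => (exp (/ (1 - sqrt (Cmod q))) * sqrt (Cmod q) ^ m)%R).
  - intros m. replace (s m - part_gf d r q (S (S m)) 1 - 0)
      with (s m - part_gf d r q (S (S m)) 1) by ring.
    rewrite Rmult_comm. apply Ccount_partial_sum_dist; auto. nia.
  - now apply is_lim_seq_geom_scal.
Qed.

(** * Specialization to q = exp (2 pi i tau) *)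

Lemma cexp_plus (u v : C) : cexp (u + v) = cexp u * cexp v.
Proof.
  destruct u as [u1 u2], v as [v1 v2]. unfold cexp, Cmult, Cplus; simpl.
  rewrite exp_plus, cos_plus, sin_plus. f_equal; ring.
Qed.

Lemma qp_plus (tau : C) (x y : R) : qp tau (x + y) = qp tau x * qp tau y.
Proof.
  unfold qp. rewrite <- cexp_plus. f_equal.
  rewrite Rmult_plus_distr_l, RtoC_plus. ring.
Qed.

Lemma qp_0 (tau : C) : qp tau 0 = 1.
Proof.
  unfold qp. rewrite Rmult_0_r. replace (0 * Ci * tau) with (RtoC 0) by ring.
  unfold cexp; simpl. rewrite exp_0, cos_0, sin_0. unfold RtoC. f_equal; ring.
Qed.

Lemma qp_neq_0 (tau : C) (x : R) : qp tau x <> 0.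
Proof.
  intros E. assert (H := qp_plus tau x (- x)). rewrite Rplus_opp_r, qp_0, E in H.
  apply C1_nz. rewrite H. ring.
Qed.

Lemma qp_INR (tau : C) (n : nat) : qp tau (INR n) = qp tau 1 ^ n.
Proof.
  induction n as [|n IH]; [apply qp_0|].
  rewrite S_INR, qp_plus, IH. simpl. ring.
Qed.

Lemma qp_scal (tau : C) (c x : R) : qp (c * tau) x = qp tau (c * x).
Proof. unfold qp. f_equal. rewrite !RtoC_mult. ring. Qed.

Lemma Cmod_cexp (z : C) : Cmod (cexp z) = exp (Re z).
Proof.
  destruct z as [x y]. unfold cexp, Cmod, Re, Im, fst, snd.
  replace ((exp x * cos y) ^ 2 + (exp x * sin y) ^ 2)%R
    with (exp x * exp x * (Rsqr (sin y) + Rsqr (cos y)))%R by (unfold Rsqr; ring).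
  rewrite sin2_cos2, Rmult_1_r. apply sqrt_square, Rlt_le, exp_pos.
Qed.

Lemma Cmod_qp_lt_1 (tau : C) : (0 < Im tau)%R -> (Cmod (qp tau 1) < 1)%R.
Proof.
  intros H. destruct tau as [x y]. simpl in H. unfold qp.
  set (u := RtoC (2 * PI * 1) * Ci * (x, y)).
  assert (Hre : (Re u < 0)%R).
  { unfold u, Ci, RtoC, Cmult, Re; simpl. assert (P := PI_RGT_0). nra. }
  rewrite Cmod_cexp, <- exp_0. now apply exp_increasing.
Qed.

(** With w = 1/2 + r tau the theta exponent contains 2 pi i n (1/2 + 1/2) with n half-odd, so every
    theta term has the same sign -1; this agrees with the minus signs in a and b. *)
Lemma cexp_half_odd (m : nat) :
  cexp (RtoC (2 * PI * (INR m + 1 / 2)) * Ci) = - (1) /\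
  cexp (RtoC (2 * PI * - (INR m + 1 / 2)) * Ci) = - (1).
Proof.
  assert (Hc : cos (2 * PI * (INR m + 1 / 2)) = (-1)%R).
  { replace (2 * PI * (INR m + 1 / 2))%R with (PI + 2 * INR m * PI)%R by field.
    rewrite cos_period. apply cos_PI. }
  assert (Hs : sin (2 * PI * (INR m + 1 / 2)) = 0%R).
  { replace (2 * PI * (INR m + 1 / 2))%R with (PI + 2 * INR m * PI)%R by field.
    rewrite sin_period. apply sin_PI. }
  assert (E : forall x : R, cexp (RtoC x * Ci) = (cos x, sin x)).
  { intros x. unfold cexp, Ci, RtoC, Cmult; simpl.
    replace (x * 0 - 0 * 1)%R with 0%R by ring. replace (x * 1 + 0 * 0)%R with x by ring.
    rewrite exp_0. f_equal; ring. }
  split; rewrite E.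
  - rewrite Hc, Hs. unfold Copp, RtoC; simpl. f_equal; ring.
  - rewrite Ropp_mult_distr_r_reverse, cos_neg, sin_neg, Hc, Hs.
    unfold Copp, RtoC; simpl. f_equal; ring.
Qed.

Lemma theta_term_qp (d r : R) (tau : C) (m : Z) :
  let nu := (IZR m + 1 / 2)%R in
  theta_term (RtoC (1 / 2) + r * tau) (d * tau) m =
  cexp (RtoC (2 * PI * nu) * Ci) * qp tau (nu * nu * d / 2 + nu * r).
Proof.
  intros nu. unfold theta_term, qp. fold nu. rewrite <- cexp_plus. f_equal.
  unfold Rdiv. rewrite !RtoC_mult, RtoC_plus, !RtoC_mult, RtoC_inv by lra.
  field.
Qed.

Lemma INR_tri (n : nat) : (2 * INR (tri n) = INR n * INR n - INR n)%R.
Proof.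
  assert (H := f_equal INR (tri_double n)).
  rewrite plus_INR, !mult_INR in H. simpl (INR 2) in H. lra.
Qed.

(** Completing the exponent at n = k + 1/2 gives d/8 - r/2 + d k(k + 1)/2 + r(k + 1): a power of q^r
    that starts at exponent 1. *)
Lemma theta_term_nonneg (d r : nat) (tau : C) (k : nat) :
  theta_term (RtoC (1 / 2) + INR r * tau) (INR d * tau) (Z.of_nat k) =
  - qp tau (INR d / 8 - INR r / 2) *
    ((qp tau 1 ^ d) ^ tri (S k) * (qp tau 1 ^ r) ^ S k).
Proof.
  rewrite theta_term_qp, <- INR_IZR_INZ.
  rewrite (proj1 (cexp_half_odd k)), <- !Cpow_mult_r, <- Cpow_add_r, <- qp_INR.
  replace (- qp tau (INR d / 8 - INR r / 2) * qp tau (INR (d * tri (S k) + r * S k)))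
    with (- (1) * (qp tau (INR d / 8 - INR r / 2) * qp tau (INR (d * tri (S k) + r * S k)))) by ring.
  rewrite <- qp_plus. do 2 f_equal. rewrite plus_INR, !mult_INR.
  replace (INR (tri (S k))) with ((INR (S k) * INR (S k) - INR (S k)) / 2)%R
    by (rewrite <- INR_tri; field).
  rewrite S_INR. field.
Qed.

(** Here n = -(k + 1/2), and absorbing dk into the linear term turns -rk into (d - r)k, starting at
    exponent 0. *)
Lemma theta_term_neg (d r : nat) (tau : C) (k : nat) :
  (r <= d)%nat ->
  theta_term (RtoC (1 / 2) + INR r * tau) (INR d * tau) (- Z.of_nat k - 1) =
  - qp tau (INR d / 8 - INR r / 2) *
    ((qp tau 1 ^ d) ^ tri k * (qp tau 1 ^ (d - r)) ^ k).
Proof.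
  intros Hrd. rewrite theta_term_qp.
  replace (IZR (- Z.of_nat k - 1) + 1 / 2)%R with (- (INR k + 1 / 2))%R
    by (rewrite minus_IZR, opp_IZR, <- INR_IZR_INZ; field).
  rewrite (proj2 (cexp_half_odd k)), <- !Cpow_mult_r, <- Cpow_add_r, <- qp_INR.
  replace (- qp tau (INR d / 8 - INR r / 2) * qp tau (INR (d * tri k + (d - r) * k)))
    with (- (1) * (qp tau (INR d / 8 - INR r / 2) * qp tau (INR (d * tri k + (d - r) * k)))) by ring.
  rewrite <- qp_plus. do 2 f_equal. rewrite plus_INR, !mult_INR, minus_INR by auto.
  replace (INR (tri k)) with ((INR k * INR k - INR k) / 2)%R
    by (rewrite <- INR_tri; field).
  field.
Qed.

Local Close Scope C_scope.

Theorem theorem1p2 (d r : nat) (tau : C)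
  (Hd : (3 <= d)%nat) (Hr1 : (1 <= r)%nat) (Hr2 : (2 * r < d)%nat)
  (Htau : 0 < Im tau) :
  exists (Cq th et g : C),
    is_series (fun n : nat => Cmult (RtoC (INR (Ccount d r n))) (pow_n (qp tau 1) n)) Cq /\
    is_theta (Cplus (RtoC (1/2)) (Cmult (RtoC (INR r)) tau))
             (Cmult (RtoC (INR d)) tau) th /\
    is_eta (Cmult (RtoC (INR d)) tau) et /\
    is_g3 (Copp (qp tau (INR r))) (qp tau (INR d)) g /\
    Cq = Copp (Cmult (Cmult (qp tau (- INR d / 12 + INR r / 2)) (Cdiv th et)) g).
Proof.
  assert (Hq := Cmod_qp_lt_1 tau Htau).
  set (q := qp tau 1) in *.
  set (a := Copp (Cpow q r)). set (b := Copp (Cpow q (d - r))). set (Q := Cpow q d).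
  assert (HQ : Cmod Q < 1) by (apply Cmod_pow_lt_1; auto; lia).
  assert (Ha : Cmod a < 1) by (unfold a; rewrite Cmod_opp; apply Cmod_pow_lt_1; auto; lia).
  assert (Hb : Cmod b < 1) by (unfold b; rewrite Cmod_opp; apply Cmod_pow_lt_1; auto; lia).
  assert (HQ0 : Q <> RtoC 0) by (apply Cpow_nz, qp_neq_0).
  assert (Hab : Cmult a b = Q).
  { unfold a, b, Q. replace d with (r + (d - r))%nat at 2 by lia. rewrite Cpow_add_r. ring. }
  destruct (qpoch_cv Q Q HQ HQ) as [P [HP HP0]].
  destruct (qpoch_cv a Q Ha HQ) as [A [HA HA0]].
  destruct (qpoch_cv b Q Hb HQ) as [B [HB HB0]].
  set (F := qsol a b Q P 0).
  set (s := cseries (fun k => Cmult (Cpow Q (tri k)) (Cpow (Copp b) k))).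
  set (t := cseries (fun k => Cmult (Cpow Q (tri (S k))) (Cpow (Copp a) (S k)))).
  assert (Hs : clim (fun n => csum n (fun k => Cmult (Cpow Q (tri k)) (Cpow (Copp b) k))) s).
  { apply cseries_geom_cv with 1 (Cmod b); [split; auto using Cmod_ge_0|].
    intros j. rewrite <- (Cmod_opp b). now apply tri_term_le. }
  assert (Ht : clim (fun n => csum n (fun k => Cmult (Cpow Q (tri (S k))) (Cpow (Copp a) (S k)))) t).
  { apply cseries_geom_cv with (Cmod a) (Cmod a); [split; auto using Cmod_ge_0|].
    intros j. eapply Rle_trans; [now apply tri_term_le|]. rewrite Cmod_opp. simpl. lra. }
  assert (Hba : Cmult b a = Q) by (rewrite <- Hab; ring).
  (* The roles of a and b are exchanged: the theta terms in q^(d-r) include exponent 0, those in q^r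
     begin at 1. *)
  assert (JTP := triple_product Q b a B A P s t Hba HQ0 Hb Ha HB HA HP HP0 Hs Ht).
  set (c1 := Copp (qp tau (INR d / 8 - INR r / 2))).
  exists F, (Cmult c1 (Cplus t s)), (Cmult (qp tau (INR d / 24)) P), (Cdiv F (Cmult A B)).
  assert (Eb : Copp b = Cpow q (d - r)) by (unfold b; ring).
  assert (Ea : Copp a = Cpow q r) by (unfold a; ring).
  split; [|split; [|split; [|split]]].
  - apply is_series_clim.
    apply clim_ext with (fun m => csum m (fun n => Cmult (RtoC (INR (Ccount d r n))) (Cpow q n))).
    + intros m. apply csum_ext. intros j _. now rewrite (pow_n_Cpow q j).
    + now apply Ccount_series.
  - exists (Cmult c1 t), (Cmult c1 s). split; [|split; [|ring]]; apply is_series_clim.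
    + apply clim_ext with (2 := clim_scal _ c1 _ Ht). intros n. rewrite <- csum_scal.
      apply csum_ext. intros k _. rewrite theta_term_nonneg, Ea. reflexivity.
    + apply clim_ext with (2 := clim_scal _ c1 _ Hs). intros n. rewrite <- csum_scal.
      apply csum_ext. intros k _. rewrite theta_term_neg, Eb by lia. reflexivity.
  - exists P. split.
    + apply clim_filterlim. apply clim_ext with (2 := HP). intros n.
      rewrite qpoch_Cpow. apply cprod_ext. intros j _.
      rewrite qp_scal, <- mult_INR, qp_INR, Nat.mul_succ_r, Nat.add_comm, Cpow_add_r, Cpow_mult_r.
      reflexivity.
    + rewrite qp_scal. do 2 f_equal. field.
  - rewrite !qp_INR. fold q. fold Q. fold a. now apply g3_eq.
  - replace (Cplus t s) with (Cmult (Cmult B A) P) by (rewrite JTP; ring).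
    (* Since -d/12 + d/8 = d/24, the prefactors leave minus the q^(d/24) of eta; P cancels too, so
       the theta quotient with its prefactor is -AB. *)
    assert (E : Cmult (qp tau (- INR d / 12 + INR r / 2)) c1 = Copp (qp tau (INR d / 24))).
    { unfold c1.
      replace (INR d / 24) with ((- INR d / 12 + INR r / 2) + (INR d / 8 - INR r / 2)) by field.
      rewrite (qp_plus tau (- INR d / 12 + INR r / 2)). ring. }
    assert (Hn := qp_neq_0 tau (INR d / 24)).
    transitivity (Copp (Cmult (Cmult (Cmult (qp tau (- INR d / 12 + INR r / 2)) c1)
      (Cdiv (Cmult (Cmult B A) P) (Cmult (qp tau (INR d / 24)) P))) (Cdiv F (Cmult A B)))).
    + rewrite E. field. auto.
    + field. auto.
Qed.
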